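(* Let $\mathbb{X}$ and $\mathbb{Y}$ be Hilbert spaces, $\Omega\subseteq\mathbb{X}$ an open set and $F:\Omega\to\mathbb{Y}$ a continuously differentiable function such that $F'(x)$ has closed image for every $x\in\Omega$. Let $x_*\in\Omega$, $R>0$, $\beta:=\|F'(x_* )^{\dagger}\|$ and $\kappa:=\sup\{t\in[0,R): B(x_*,t)\subset\Omega\}$. Suppose that $F(x_* )=0$, that $F'(x_* )$ is injective, and that there exists a positive integrable function $L:[0,R)\to\mathbb{R}$ such that $$\beta\|F'(x)-F'(x_*+\tau(x-x_* ))\|\le\int_{\tau\|x-x_*\|}^{\|x-x_*\|}L(u)\,du$$ for all $\tau\in[0,1]$ and $x\in B(x_*,\kappa)$. Take $0\le\vartheta<1$ and $0\le\omega_2<\omega_1$ such that $\omega_1\vartheta+\omega_2<1$. Let $\bar\nu:=\sup\{t\in[0,R):\int_0^tL(u)\,du-1<0\}$, $$\bar\rho:=\sup\left\{\delta\in(0,\bar\nu): \frac{(1+\vartheta)\omega_1\int_0^tL(u)u\,du}{t\left(1-\int_0^tL(u)\,du\right)}+\omega_1\vartheta+\omega_2<1\text{ for all }t\in(0,\delta)\right\},\qquad \bar r:=\min\{\kappa,\bar\rho\}.$$ Consider the inexact Gauss-Newton like method with initial point $x_0\in B(x_*,\bar r)\setminus\{x_*\}$ defined by $$x_{k+1}=x_k+S_k,\qquad B(x_k)S_k=-F'(x_k)^*F(x_k)+r_k,\qquad k=0,1,\ldots,$$ where $B(x_k)$ is an invertible approximation of $F'(x_k)^*F'(x_k)$ satisfying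 $$\|B(x_k)^{-1}F'(x_k)^*F'(x_k)\|\le\omega_1,\qquad \|B(x_k)^{-1}F'(x_k)^*F'(x_k)-I\|\le\omega_2,\qquad k=0,1,\ldots,$$ and the residual $r_k\in\mathbb{X}$, the forcing term $\theta_k$ and the invertible preconditioner $P_k$ are such that $$\|P_kr_k\|\le\theta_k\|P_kF'(x_k)^*F(x_k)\|,\qquad 0\le\theta_k\,\mathrm{cond}(P_kF'(x_k)^*F'(x_k))\le\vartheta,\qquad k=0,1,\ldots.$$ Define the scalar sequence $\{t_k\}$ by $t_0=\|x_0-x_*\|$ and $$t_{k+1}=\frac{(1+\vartheta)\omega_1\int_0^{t_k}L(u)u\,du}{1-\int_0^{t_k}L(u)\,du}+(\omega_1\vartheta+\omega_2)t_k,\qquad k=0,1,\ldots.$$ Then the sequences $\{x_k\}$ and $\{t_k\}$ are well defined; $\{t_k\}$ is strictly decreasing, contained in $(0,\bar r)$ and converges to $0$. Furthermore, $\{x_k\}$ is contained in $B(x_*,\bar r)$, converges to $x_*$, and $$\limsup_{k\to\infty}\frac{\|x_{k+1}-x_*\|}{\|x_k-x_*\|}\le\omega_1\vartheta+\omega_2,\qquad \lim_{k\to\infty}\frac{t_{k+1}}{t_k}=\omega_1\vartheta+\omega_2.$$ If, additionally, for a given $0\le p\le1$, the function $(0,\bar\nu)\ni t\mapsto t^{1-p}L(t)$ is nondecreasing, then $$\|x_{k+1}-x_*\|\le(1+\vartheta)\omega_1\left(\frac{\int_0^{t_0}L(u)u\,du}{t_0^{p+1}\left(1-\int_0^{t_0}L(u)\,du\right)}\right)\|x_k-x_*\|^{p+1}+(\omega_1\vartheta+\omega_2)\|x_k-x_*\|,\qquad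 k=0,1,\ldots,$$ and $\|x_k-x_*\|\le t_k$ for all $k=0,1,\ldots$.
   Context: Hilbert spaces are real or complex. $B(a,\delta)=\{x\in\mathbb{X}:\|x-a\|<\delta\}$ is the open ball. $A^*$ denotes the adjoint of a continuous linear operator $A$. For a continuous injective linear operator $A:\mathbb{X}\to\mathbb{Y}$ with closed image, $A^{\dagger}:=(A^*A)^{-1}A^*$ is its Moore-Penrose inverse. For an invertible continuous linear operator $A$, $\mathrm{cond}(A):=\|A^{-1}\|\|A\|$. The operators $B(x_k)$ and $P_k$ are invertible continuous linear operators $\mathbb{X}\to\mathbb{X}$ (''approximation'' has no meaning beyond the stated inequalities); $I$ is the identity of $\mathbb{X}$; the $\theta_k$ are real numbers. Well-definedness of $\{x_k\}$ includes that each $F'(x_k)^*F'(x_k)$ is invertible and each iterate stays in $\Omega$. *)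

(* Defs.v *)
From HB Require Import structures.
From mathcomp Require Import all_boot all_order all_algebra.
From mathcomp Require Import complex.
From mathcomp Require Import all_classical all_reals all_analysis.
Set Implicit Arguments.
Unset Strict Implicit.
Unset Printing Implicit Defensive.
Import Order.TTheory GRing.Theory Num.Theory.
Import numFieldNormedType.Exports.
Local Open Scope classical_set_scope.
Local Open Scope ring_scope.

Inductive scalar_kind : Set := RealScalars | ComplexScalars.

Definition scalar (R : realType) (s : scalar_kind) : numFieldType :=
  match s with RealScalars => R | ComplexScalars => R[i] end.

Definition scalar_of_real (R : realType) (s : scalar_kind) :
    R -> scalar R s :=
  match s with
  | RealScalars => fun a => a
  | ComplexScalars => fun a => a%:C%C
  end.

Definition scalar_re (R : realType) (s : scalar_kind) : scalar R s -> R :=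
  match s with
  | RealScalars => fun a => a
  | ComplexScalars => fun a => complex.Re a
  end.

Definition scalar_conj (R : realType) (s : scalar_kind) :
    scalar R s -> scalar R s :=
  match s with
  | RealScalars => fun a => a
  | ComplexScalars => fun a => conjc a
  end.

(* The inner product is linear in its first argument and conjugate-linear in
   its second one. *)
Record hilbertType (R : realType) (s : scalar_kind) := HilbertType {
  hilbert_sort :> completeNormedModType (scalar R s) ;
  inner : {dot hilbert_sort for @scalar_conj R s} ;
  inner_norm : forall x : hilbert_sort, `|x| ^+ 2 = inner x x
}.

(* In MathComp the norm of a normed module takes its values in the scalar
   field; hnorm is the same norm, with values in the reals. *)
Definition hnorm (R : realType) (s : scalar_kind) (X : hilbertType R s)
  (x : X) : R := scalar_re `|x|.

Definition oball (R : realType) (s : scalar_kind) (X : hilbertType R s)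
  (a : X) (d : R) : set X := [set x | hnorm (x - a) < d].

Section Operators.
Context {R : realType} {s : scalar_kind}.
Implicit Types X Y : hilbertType R s.

(* The set is bounded when A is linear and continuous, the only case used. *)
Definition opnorm X Y (A : X -> Y) : R :=
  sup [set hnorm (A x) | x in [set x : X | hnorm x <= 1]].

(* For A linear and continuous, the Riesz theorem provides exactly one u. *)
Definition adjoint X Y (A : X -> Y) (y : Y) : X :=
  xget 0 [set u : X | forall x : X, inner Y (A x) y = inner X x u].

(* Meaningful when A is bijective. *)
Definition opinv X Y (A : X -> Y) (y : Y) : X := xget 0 [set x : X | A x = y].

Definition op_invertible X Y (A : X -> Y) : Prop :=
  [/\ linear A, continuous A &
      exists G : Y -> X, [/\ linear G, continuous G, cancel A G & cancel G A]].

Definition mp_inverse X Y (A : X -> Y) : Y -> X :=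
  opinv (adjoint A \o A) \o adjoint A.

Definition cond X Y (A : X -> Y) : R := opnorm (opinv A) * opnorm A.

Definition continuously_differentiable_on X Y (Omega : set X) (F : X -> Y) :
    Prop :=
  forall z, Omega z ->
    differentiable F z /\ opnorm ('d F w \- 'd F z) @[w --> z] --> (0 : R).

Definition normal_op X Y (F : X -> Y) (z : X) : X -> X :=
  adjoint ('d F z) \o 'd F z.

(* The points from which one step of the method can be performed. The steps of
   a run are only constrained at such points, so that the run being well defined
   is something to prove. *)
Definition admissible X Y (Omega : set X) (F : X -> Y) (z : X) : Prop :=
  Omega z /\ op_invertible (normal_op F z).

Definition kappa_radius X (Omega : set X) (xs : X) (rad : R) : R :=
  sup [set t | 0 <= t < rad /\ oball xs t `<=` Omega].

End Operators.

Section Majorant.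
Context {R : realType}.
Implicit Types (L : R -> R).

Definition defint (a b : R) (f : R -> R) : R :=
  \int[lebesgue_measure]_(u in `[a, b]) f u.

Definition nu_bar L (rad : R) : R :=
  sup [set t | 0 <= t < rad /\ defint 0 t L - 1 < 0].

Definition rho_bar L (rad th w1 w2 : R) : R :=
  sup [set d | 0 < d < nu_bar L rad /\
    forall t, 0 < t < d ->
      (1 + th) * w1 * defint 0 t (fun u => L u * u)
        / (t * (1 - defint 0 t L)) + w1 * th + w2 < 1].

End Majorant.

(* Main.v *)
Require Import Defs.
From HB Require Import structures.
From mathcomp Require Import all_boot all_order all_algebra.
From mathcomp Require Import complex.
From mathcomp Require Import all_classical all_reals all_analysis.
From mathcomp Require Import ring lra.
Import Order.TTheory GRing.Theory Num.Theory.
Import numFieldNormedType.Exports.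
Local Open Scope classical_set_scope.
Local Open Scope ring_scope.
Set Implicit Arguments.
Unset Strict Implicit.
Unset Printing Implicit Defensive.

(* Write [e = |x - xs|], [G t = int_0^t L], [H t = int_0^t L(u) u du] and
   [A = F'(x)].  Injectivity and closedness of the range make [F'(xs)] bounded
   below by [1 / beta] (uniform boundedness), so the Lipschitz condition gives
   [(1 - G e) |v| <= beta |A v|] near [xs]; hence [A^*A] is invertible and
   [|A^+ y| <= beta |y| / (1 - G e)].  Integrating the Lipschitz condition along
   the segment gives [beta |A (x - xs) - F x| <= H e].  Splitting one step of the
   method into the linearization error, the error of [B^-1 A^*A] with respect to
   [I], and the residual, one finds [e' <= phi e] with [phi] the map defining
   [t].  Below [rho_bar] one has [phi t < t] for [t > 0], and by continuity of
   [G] and [H] a positive limit of [e] or [t] would be moved strictly down by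
   [phi]; so both sequences tend to 0.  The rates follow from [H t <= t G t], and
   the last part from the monotonicity of [H t / t^(p+1)]. *)

(** * Real structure of a Hilbert space *)

(** All estimates use the real part of the inner product and the real-valued norm, so real and
    complex scalars share one argument; scalar-valued identities come back only where [adjoint] is
    characterized. A single variational lemma, [subspace_representation], supplies the Riesz
    theorem, the inverse of [A^*A] and orthogonal projections. The factor [beta] stays in front of
    the norms ([beta |A v|], [beta |A h - F x|]), as in the Lipschitz condition, so [G] and [H]
    enter without constants and [1 / beta] is never formed. Increments of [F] along a segment are
    summed by a supremum argument on [[0, 1]], which replaces a vector-valued integral. The
    conditions on [B], [P] and the residual are available only at admissible points. Admissibility
    of an iterate must therefore come out of the estimate for the previous step, and the main
    induction carries membership in the ball of radius [rbar]. *)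

Section Scalars.
Context {R : realType} {s : scalar_kind}.
Implicit Types (z w : Defs.scalar R s) (a b : R).

Lemma scalar_reD z w : scalar_re (z + w) = scalar_re z + scalar_re w.
Proof. by case: s z w => //= z w; rewrite raddfD. Qed.

Lemma scalar_reN z : scalar_re (- z) = - scalar_re z.
Proof. by case: s z => //= z; rewrite raddfN. Qed.

Lemma scalar_re_conj z : scalar_re (scalar_conj z) = scalar_re z.
Proof. by case: s z => //= -[]. Qed.

Lemma scalar_re_realM a z :
  scalar_re (scalar_of_real s a * z) = a * scalar_re z.
Proof. by case: s z => //= -[u v] /=; rewrite mul0r subr0. Qed.

Lemma scalar_of_realK : cancel (scalar_of_real s) (@scalar_re R s).
Proof. by case: s. Qed.

Lemma scalar_of_realD a b :
  scalar_of_real s (a + b) = scalar_of_real s a + scalar_of_real s b.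
Proof. by case: s => //=; rewrite rmorphD. Qed.

Lemma scalar_of_realB a b :
  scalar_of_real s (a - b) = scalar_of_real s a - scalar_of_real s b.
Proof. by case: s => //=; rewrite rmorphB. Qed.

Lemma scalar_of_realM a b :
  scalar_of_real s (a * b) = scalar_of_real s a * scalar_of_real s b.
Proof. by case: s => //=; rewrite rmorphM. Qed.

Lemma scalar_of_real0 : scalar_of_real s (0 : R) = 0.
Proof. by case: s. Qed.

Lemma scalar_of_real1 : scalar_of_real s (1 : R) = 1.
Proof. by case: s. Qed.

Lemma scalar_of_real_ler a b :
  (scalar_of_real s a <= scalar_of_real s b) = (a <= b).
Proof. by case: s => //=; rewrite lecR. Qed.

Lemma scalar_of_real_ltr a b :
  (scalar_of_real s a < scalar_of_real s b) = (a < b).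
Proof. by case: s => //=; rewrite ltcR. Qed.

Lemma scalar_re_ge0E z : 0 <= z -> scalar_of_real s (scalar_re z) = z.
Proof.
case: s z => //= -[u v]; rewrite lecE /= => /andP[/eqP -> _].
by [].
Qed.

Lemma scalar_of_real_norm a :
  `|scalar_of_real s a| = scalar_of_real s `|a|.
Proof. by case: s => //=; rewrite normc_def /= expr0n addr0 sqrtr_sqr. Qed.

(** Testing with 1 and with the imaginary unit recovers both parts of a complex number. This lifts
    identities between real parts to scalar-valued ones. *)
Lemma scalar_re_ext z w :
  (forall c, scalar_re (c * z) = scalar_re (c * w)) -> z = w.
Proof.
case: s z w => /= z w h; first by have := h 1; rewrite !mul1r.
have h1 := h 1; have h2 := h 'i%C; rewrite !mul1r in h1.
case: z w h1 h2 {h} => [a b] [c d] /= -> /eqP.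
by rewrite !mul0r !mul1r !add0r eqr_opp => /eqP ->.
Qed.

End Scalars.

Section RealStructure.
Context {R : realType} {s : scalar_kind}.
Implicit Types X Y : hilbertType R s.

(** Together with [rscale] this makes [X] a real Hilbert space with the same norm, whatever the
    scalars. *)
Definition rinner X (x y : X) : R := scalar_re (inner X x y).

Definition rscale X (a : R) (x : X) : X := scalar_of_real s a *: x.

Lemma normE X (x : X) : `|x| = scalar_of_real s (hnorm x).
Proof. by rewrite /hnorm scalar_re_ge0E. Qed.

Lemma hnorm_ge0 X (x : X) : 0 <= hnorm x.
Proof. by rewrite -(@scalar_of_real_ler R s) scalar_of_real0 -normE. Qed.
Hint Resolve hnorm_ge0 : core.

Lemma hnormD X (x y : X) : hnorm (x + y) <= hnorm x + hnorm y.
Proof.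
by rewrite -(@scalar_of_real_ler R s) scalar_of_realD -!normE ler_normD.
Qed.

Lemma hnormN X (x : X) : hnorm (- x) = hnorm x.
Proof. by rewrite /hnorm normrN. Qed.

Lemma hnormB X (x y : X) : hnorm (x - y) <= hnorm x + hnorm y.
Proof. by rewrite -[hnorm y]hnormN hnormD. Qed.

Lemma hdistC X (x y : X) : hnorm (x - y) = hnorm (y - x).
Proof. by rewrite /hnorm distrC. Qed.

Lemma hnormZ X (c : Defs.scalar R s) (x : X) :
  hnorm (c *: x) = scalar_re `|c| * hnorm x.
Proof.
rewrite /hnorm normrZ -[`|c| in LHS](scalar_re_ge0E (normr_ge0 c)).
by rewrite scalar_re_realM.
Qed.

Lemma hnorm_rscale X (a : R) (x : X) : hnorm (rscale a x) = `|a| * hnorm x.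
Proof. by rewrite /rscale hnormZ scalar_of_real_norm scalar_of_realK. Qed.

Lemma hnorm0 X : hnorm (0 : X) = 0.
Proof. by rewrite /hnorm normr0 -scalar_of_real0 scalar_of_realK. Qed.

Lemma hnorm_eq0 X (x : X) : (hnorm x == 0) = (x == 0).
Proof.
apply/eqP/eqP => [h|->]; last exact: hnorm0.
by apply/eqP; rewrite -normr_eq0 normE h scalar_of_real0.
Qed.

Lemma hnorm_gt0 X (x : X) : (0 < hnorm x) = (x != 0).
Proof. by rewrite lt_neqAle hnorm_ge0 andbT eq_sym hnorm_eq0. Qed.

Lemma innerC X (x y : X) : inner X x y = scalar_conj (inner X y x).
Proof.
by have := @hermitian_subproof _ _ _ _ (inner X) x y; rewrite expr0 mul1r.
Qed.

Lemma innerZl X c (x y : X) : inner X (c *: x) y = c * inner X x y.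
Proof. exact: linearZl_LR. Qed.

Lemma innerZr X c (x y : X) : inner X x (c *: y) = scalar_conj c * inner X x y.
Proof. exact: linearZr_LR. Qed.

Lemma innerDr X (x y z : X) : inner X z (x + y) = inner X z x + inner X z y.
Proof. exact: linearDr. Qed.

Lemma rinnerC X (x y : X) : rinner x y = rinner y x.
Proof. by rewrite /rinner innerC scalar_re_conj. Qed.

Lemma rinnerDl X (x y z : X) : rinner (x + y) z = rinner x z + rinner y z.
Proof. by rewrite /rinner linearDl scalar_reD. Qed.

Lemma rinnerDr X (x y z : X) : rinner z (x + y) = rinner z x + rinner z y.
Proof. by rewrite !(rinnerC z) rinnerDl. Qed.

Lemma rinnerNl X (x y : X) : rinner (- x) y = - rinner x y.
Proof. by rewrite /rinner linearNl scalar_reN. Qed.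

Lemma rinnerNr X (x y : X) : rinner x (- y) = - rinner x y.
Proof. by rewrite !(rinnerC x) rinnerNl. Qed.

Lemma rinnerBl X (x y z : X) : rinner (x - y) z = rinner x z - rinner y z.
Proof. by rewrite rinnerDl rinnerNl. Qed.

Lemma rinnerBr X (x y z : X) : rinner z (x - y) = rinner z x - rinner z y.
Proof. by rewrite rinnerDr rinnerNr. Qed.

Lemma rinnerZl X a (x y : X) : rinner (rscale a x) y = a * rinner x y.
Proof. by rewrite /rinner innerZl scalar_re_realM. Qed.

Lemma rinnerZr X a (x y : X) : rinner x (rscale a y) = a * rinner x y.
Proof. by rewrite !(rinnerC x) rinnerZl. Qed.

Lemma rinner_norm X (x : X) : rinner x x = hnorm x ^+ 2.
Proof.
by rewrite /rinner -inner_norm normE expr2 scalar_re_realM scalar_of_realK.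
Qed.

Lemma rinner0l X (y : X) : rinner 0 y = 0.
Proof. by rewrite -(subrr 0) rinnerBl subrr. Qed.

Lemma rinner0r X (y : X) : rinner y 0 = 0.
Proof. by rewrite rinnerC rinner0l. Qed.

Lemma rinner_ext X (u v : X) : (forall x, rinner x u = rinner x v) -> u = v.
Proof.
move=> h; apply/eqP; rewrite -subr_eq0 -hnorm_eq0 -sqrf_eq0 -rinner_norm.
by rewrite rinnerBr h subrr.
Qed.

Lemma hnormD_sq X (x y : X) :
  hnorm (x + y) ^+ 2 = hnorm x ^+ 2 + 2 * rinner x y + hnorm y ^+ 2.
Proof.
by rewrite -!rinner_norm !rinnerDl !rinnerDr (rinnerC y x); ring.
Qed.

Lemma hnormB_sq X (x y : X) :
  hnorm (x - y) ^+ 2 = hnorm x ^+ 2 - 2 * rinner x y + hnorm y ^+ 2.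
Proof. by rewrite hnormD_sq hnormN rinnerNr; ring. Qed.

Lemma cauchy_schwarz X (x y : X) : `|rinner x y| <= hnorm x * hnorm y.
Proof.
suff h (u : X) : rinner u y <= hnorm u * hnorm y.
  rewrite ler_norml h andbT lerNl -rinnerNl.
  by rewrite -[hnorm x]hnormN h.
have [->|y0] := eqVneq y 0; first by rewrite rinner0r hnorm0 mulr0.
have yp : 0 < hnorm y by rewrite hnorm_gt0.
have [->|u0] := eqVneq u 0; first by rewrite rinner0l hnorm0 mul0r.
have up : 0 < hnorm u by rewrite hnorm_gt0.
(* The square expands to [2 |y| |u| (|y| |u| - <u, y>)], and the factor in front is positive. *)
have := sqr_ge0 (hnorm (rscale (hnorm y) u - rscale (hnorm u) y)).
rewrite hnormB_sq rinnerZl rinnerZr !hnorm_rscale !ger0_norm //.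
move=> h; rewrite -subr_ge0 -(pmulr_rge0 _ (mulr_gt0 yp up)).
by lra.
Qed.

Lemma rinner_le X (x y : X) : rinner x y <= hnorm x * hnorm y.
Proof. exact: le_trans (ler_norm _) (cauchy_schwarz _ _). Qed.

Lemma hnorm_triangle X (x y z : X) :
  hnorm (x - z) <= hnorm (x - y) + hnorm (y - z).
Proof. by rewrite (_ : x - z = (x - y) + (y - z)) ?hnormD// addrA subrK. Qed.

Lemma rscaleBr X a (x y : X) : rscale a (x - y) = rscale a x - rscale a y.
Proof. exact: scalerBr. Qed.

Lemma rscaleBl X a b (x : X) : rscale (a - b) x = rscale a x - rscale b x.
Proof. by rewrite /rscale scalar_of_realB scalerBl. Qed.

Lemma rscaleA X a b (x : X) : rscale a (rscale b x) = rscale (a * b) x.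
Proof. by rewrite /rscale scalar_of_realM scalerA. Qed.

Lemma rscale1 X (x : X) : rscale 1 x = x.
Proof. by rewrite /rscale scalar_of_real1 scale1r. Qed.

Lemma rscale0 X (x : X) : rscale 0 x = 0.
Proof. by rewrite /rscale scalar_of_real0 scale0r. Qed.

End RealStructure.
#[global] Hint Extern 0 (is_true (0 <= hnorm _)) => exact: hnorm_ge0 : core.

(** * Limits, continuity and differentiability in terms of the real norm *)

Section RealTopology.
Context {R : realType} {s : scalar_kind}.
Implicit Types X Y : hilbertType R s.

(** A positive element of [R[i]] is real, so a library epsilon ranging over the scalars may be
    replaced by a real one. *)
Lemma scalar_gt0P (P : Defs.scalar R s -> Prop) :
  (forall e : R, 0 < e -> P (scalar_of_real s e)) <-> (forall e, 0 < e -> P e).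
Proof.
split=> h e e0; last by apply: h; rewrite -scalar_of_real0 scalar_of_real_ltr.
rewrite -(scalar_re_ge0E (ltW e0)); apply: h.
by rewrite -(@scalar_of_real_ltr R s) scalar_re_ge0E ?scalar_of_real0 // ltW.
Qed.

Lemma norm_ltE X (x : X) e : (`|x| < scalar_of_real s e) = (hnorm x < e).
Proof. by rewrite normE scalar_of_real_ltr. Qed.

Lemma hcvgP X (u : nat -> X) (l : X) :
  (u @ \oo --> l) <->
  forall e, 0 < e -> exists N, forall n, (N <= n)%N -> hnorm (u n - l) < e.
Proof.
split=> [/cvgrPdist_lt h e e0|h].
  have /h : 0 < scalar_of_real s e.
    by rewrite -scalar_of_real0 scalar_of_real_ltr.
  by case=> N _ hN; exists N => n /hN /=; rewrite norm_ltE hdistC.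
apply/cvgrPdist_lt; apply/scalar_gt0P => e /h [N hN].
by exists N => // n /hN /=; rewrite norm_ltE hdistC.
Qed.

Lemma hcomplete X (u : nat -> X) :
  (forall e, 0 < e -> exists N, forall n m, (N <= n)%N -> (N <= m)%N ->
     hnorm (u n - u m) < e) ->
  exists l, forall e, 0 < e -> exists N, forall n, (N <= n)%N ->
     hnorm (u n - l) < e.
Proof.
move=> h; suff : cvg (u @ \oo) by move=> /cvg_ex[l /hcvgP ?]; exists l.
apply: cauchy_cvg; apply: cauchy_exP; apply/scalar_gt0P => e /h [N hN].
exists (u N), N => // n /= Nn; rewrite -ball_normE /ball_ /=.
by rewrite norm_ltE; exact: hN.
Qed.

Lemma closed_adherent X (V : set X) : closed V ->
  forall l, (forall e, 0 < e -> exists2 v, V v & hnorm (l - v) < e) -> V l.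
Proof.
move=> cV l h; apply: cV => B /nbhs_ballP [e /= e0 eB].
suff : exists2 v, V v & ball l e v by case=> v Vv /eB Bv; exists v.
move: e0 {eB}; move: e; apply/scalar_gt0P => e /h [v Vv vl]; exists v => //.
by rewrite -ball_normE /ball_ /= norm_ltE.
Qed.

Definition bounded_op X Y (A : X -> Y) :=
  exists2 M, 0 <= M & forall x, hnorm (A x) <= M * hnorm x.

(** [adjoint] and [opinv] are plain functions obtained by choice, so linearity travels as a
    hypothesis and is bundled only to borrow library lemmas. *)
Let pack_linear X Y (f : X -> Y) (lf : linear f) : {linear X -> Y} :=
  HB.pack f (GRing.isLinear.Build _ _ _ _ _ lf).

Lemma linear_subE X Y (A : X -> Y) : linear A -> {morph A : x y / x - y}.
Proof. by move=> lA x y; exact: (linearB (pack_linear lA)). Qed.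

Lemma linear_addE X Y (A : X -> Y) : linear A -> {morph A : x y / x + y}.
Proof. by move=> lA x y; exact: (linearD (pack_linear lA)). Qed.

Lemma linear_scaleE X Y (A : X -> Y) : linear A ->
  forall c, {morph A : x / c *: x}.
Proof. by move=> lA c x; exact: (scalable_linear lA). Qed.

Lemma linear_rscaleE X Y (A : X -> Y) : linear A ->
  forall c, {morph A : x / rscale c x}.
Proof. by move=> lA c x; exact: linear_scaleE. Qed.

Lemma linear_zeroE X Y (A : X -> Y) : linear A -> A 0 = 0.
Proof. by move=> lA; exact: (linear0 (pack_linear lA)). Qed.

Lemma linear_oppE X Y (A : X -> Y) : linear A -> {morph A : x / - x}.
Proof. by move=> lA x; exact: (linearN (pack_linear lA)). Qed.

Lemma bounded_op_continuous X Y (A : X -> Y) :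
  linear A -> bounded_op A -> continuous A.
Proof.
move=> lA [M M0 hM]; apply: (@bounded_linear_continuous _ _ _ (pack_linear lA)).
apply/ex_bound; exists (scalar_of_real s M); apply/nbhs_norm0P.
exists 1 => //= x /ltW; rewrite !normE -[1](@scalar_of_real1 R s).
rewrite scalar_of_real_ler => x1.
by rewrite /= normE scalar_of_real_ler (le_trans (hM _)) ?ler_piMr.
Qed.

Lemma continuous_bounded_op X Y (A : X -> Y) :
  linear A -> continuous A -> bounded_op A.
Proof.
move=> lA cA; have := (@linear_bounded_continuous _ _ _ (pack_linear lA)).2 cA.
move=> /linear_boundedP/pinfty_ex_gt0[M M0 hM].
have hM' : scalar_of_real s (scalar_re M) = M by rewrite scalar_re_ge0E // ltW.
exists (scalar_re M).
  by rewrite -(@scalar_of_real_ler R s) hM' scalar_of_real0 ltW.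
move=> x; have := hM x; rewrite !normE -hM' -scalar_of_realM.
by rewrite scalar_of_real_ler scalar_of_realK.
Qed.

Lemma differentiable_expansion X Y (F : X -> Y) x : differentiable F x ->
  forall e, 0 < e -> exists2 d, 0 < d & forall k, hnorm k < d ->
    hnorm (F (x + k) - F x - 'd F x k) <= e * hnorm k.
Proof.
move=> dF e e0; have /eqaddoP h := diff_locally dF.
have /h : 0 < scalar_of_real s e by rewrite -scalar_of_real0 scalar_of_real_ltr.
move=> /nbhs_norm0P[d /= d0 hd].
have dE : scalar_of_real s (scalar_re d) = d by rewrite scalar_re_ge0E // ltW.
exists (scalar_re d) => [|k kd].
  by rewrite -(@scalar_of_real_ltr R s) dE scalar_of_real0.
have := hd k; rewrite /= -dE norm_ltE => /(_ kd).
rewrite !normE -scalar_of_realM scalar_of_real_ler.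
by rewrite /= !fctE /= (addrC k) opprD addrA.
Qed.

End RealTopology.

(** * Operators on Hilbert spaces *)

Section Representation.
Context {R : realType} {s : scalar_kind}.
Implicit Types X Y : hilbertType R s.

Lemma le0_of_small_multiples (a C : R) :
  0 <= C -> (forall d, 0 < d -> a <= d * C) -> a <= 0.
Proof.
move=> C0 h; rewrite leNgt; apply/negP => a0.
have C1 : 0 < C + 1 by rewrite ltr_wpDl.
have := h (a / (C + 1)) (divr_gt0 a0 C1).
by rewrite mulrAC ler_pdivlMr //; lra.
Qed.

Definition real_subspace X (V : set X) :=
  [/\ V 0, forall x y, V x -> V y -> V (x + y) &
      forall a x, V x -> V (rscale a x)].

Definition adherent_closed X (V : set X) :=
  forall l, (forall e, 0 < e -> exists2 v, V v & hnorm (l - v) < e) -> V l.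

(* [u] minimises [|A v|^2 - 2 f v] over [V]; minimising sequences are Cauchy by
   the parallelogram identity. *)
Lemma subspace_representation X Y (V : set X) (A : X -> Y) (c M : R)
    (f : X -> R) :
  real_subspace V -> adherent_closed V -> linear A -> bounded_op A ->
  0 <= c -> (forall v, V v -> hnorm v <= c * hnorm (A v)) ->
  (forall x y, f (x + y) = f x + f y) ->
  (forall a x, f (rscale a x) = a * f x) ->
  0 <= M -> (forall x, f x <= M * hnorm x) ->
  exists2 u, V u & forall v, V v -> rinner (A v) (A u) = f v.
Proof.
move=> [V0 VD VZ] Vcl lA [K K0 AK] c0 Ac fD fZ M0 fM.
pose J x := hnorm (A x) ^+ 2 - 2 * f x.
have JE x y : J (x + y) =
    J x + 2 * (rinner (A x) (A y) - f y) + hnorm (A y) ^+ 2.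
  by rewrite /J linear_addE // hnormD_sq fD; lra.
(* Completing the square: [J v >= |A v|^2 - 2 M c |A v| = (|A v| - M c)^2 - (M c)^2]. *)
have Jlb v : V v -> - (M * c) ^+ 2 <= J v.
  move=> Vv; have fv : f v <= M * c * hnorm (A v).
    by apply: le_trans (fM v) _; rewrite -mulrA ler_wpM2l ?Ac.
  by have := sqr_ge0 (hnorm (A v) - M * c); rewrite /J; lra.
pose S : set R := [set J v | v in V].
have S_inf : has_inf S.
  split; first by exists (J 0), 0.
  by exists (- (M * c) ^+ 2) => _ [v Vv <-]; exact: Jlb.
pose D := inf S.
have DJ v : V v -> D <= J v.
  by move=> Vv; apply: ge_inf; [exact: S_inf.2 | exists v].
have [u_ hu] : {u_ : nat -> X &
    forall n, V (u_ n) /\ J (u_ n) < D + (n.+1%:R)^-1}.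
  apply: (@choice _ _ (fun n v => V v /\ J v < D + (n.+1%:R)^-1)) => n.
  have n0 : (0 : R) < (n.+1%:R)^-1 by rewrite invr_gt0 ltr0n.
  by have [_ [v Vv <-] vD] := inf_adherent n0 S_inf; exists v.
have invn (e : R) : 0 < e ->
    exists N, forall n, (N <= n)%N -> (n.+1%:R)^-1 < e.
  move=> e0; exists (Num.bound e^-1) => n Nn.
  rewrite invf_plt ?posrE ?ltr0n //.
  apply: lt_le_trans (archi_boundP _) _; first by rewrite invr_ge0 ltW.
  by rewrite ler_nat ltnW.
(* The left side equals [2 J (u_ n) + 2 J (u_ m) - 4 J m'] with [m'] the midpoint; [m'] lies in [V],
   so [J m' >= D]. *)
have par n m : hnorm (A (u_ n - u_ m)) ^+ 2 <=
    2 * (n.+1%:R)^-1 + 2 * (m.+1%:R)^-1.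
  have [Vn Jn] := hu n; have [Vm Jm] := hu m.
  have := DJ _ (VZ 2^-1 _ (VD _ _ Vn Vm)).
  rewrite /J linear_rscaleE // fZ fD hnorm_rscale exprMn real_normK ?num_real //.
  rewrite linear_addE // hnormD_sq linear_subE // hnormB_sq.
  move: Jn Jm; rewrite /J.
  by move: (n.+1%:R^-1) (m.+1%:R^-1) => i j; lra.
have [u uP] : exists l, forall e, 0 < e -> exists N, forall n, (N <= n)%N ->
    hnorm (u_ n - l) < e.
  apply: hcomplete => e e0.
  have e2 : 0 < (e / (c + 1)) ^+ 2 / 4.
    by rewrite divr_gt0 // exprn_gt0 // divr_gt0 // ltr_wpDl.
  have [N hN] := invn _ e2; exists N => n m /hN hn /hN hm.
  have Vnm : V (u_ n - u_ m).
    have [Vn _] := hu n; have [Vm _] := hu m.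
    apply: VD => //; rewrite -[u_ m]rscale1 -[- _]sub0r -(rscale0 (u_ m)).
    by rewrite -rscaleBl; exact: VZ.
  have Alt : hnorm (A (u_ n - u_ m)) < e / (c + 1).
    have ec0 : 0 <= e / (c + 1) by rewrite divr_ge0 ?addr_ge0 ?ler01 ?(ltW e0).
    rewrite -(@ltr_pXn2r _ 2) ?nnegrE //.
    apply: le_lt_trans (par n m) _; move: hn hm.
    by move: (n.+1%:R^-1) (m.+1%:R^-1) (_ ^+ 2) => i j k; lra.
  apply: le_lt_trans (Ac _ Vnm) _.
  have c1 : 0 < c + 1 by rewrite ltr_wpDl.
  apply: (@le_lt_trans _ _ ((c + 1) * hnorm (A (u_ n - u_ m)))).
    by rewrite ler_wpM2r // lerDl.
  by rewrite mulrC -ltr_pdivlMr.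
have Vu : V u.
  apply: Vcl => e /uP [N hN]; exists (u_ N); first exact: (hu N).1.
  by rewrite hdistC hN.
exists u => // v Vv; apply/eqP; rewrite -subr_eq0 -normr_le0.
set q := _ - _; set b := hnorm (A v).
have b0 : 0 <= b by exact: hnorm_ge0.
(* The first summand comes from near-minimality of [u_ n] along [u_ n + a v]: with
   [1 / (n + 1) < d^2], the choices [a = d] and [a = - d] bound the defect [qn]. The second pays for
   replacing [u_ n] by the limit [u]. *)
apply: (@le0_of_small_multiples _ ((1 + b ^+ 2) / 2 + b * K)).
  by rewrite addr_ge0 ?mulr_ge0 ?invr_ge0 ?addr_ge0 ?sqr_ge0.
move=> d d0.
have [N1 hN1] := uP _ d0; have [N2 hN2] := invn _ (exprn_gt0 2 d0).
pose n := maxn N1 N2.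
have {hN1} ud := hN1 n (leq_maxl _ _); have {hN2} nd := hN2 n (leq_maxr _ _).
have [Vn Jn] := hu n.
pose qn := rinner (A v) (A (u_ n)) - f v.
have qn_le a : - d ^+ 2 <= 2 * (a * qn) + a ^+ 2 * b ^+ 2.
  have := DJ _ (VD _ _ Vn (VZ a _ Vv)); rewrite JE linear_rscaleE // fZ.
  rewrite rinnerZr hnorm_rscale exprMn real_normK ?num_real // (rinnerC (A (u_ n))).
  by rewrite /qn -/b; move: Jn nd; set i := _^-1; lra.
have qn_d : `|qn| <= d * ((1 + b ^+ 2) / 2).
  have := qn_le d; have := qn_le (- d); rewrite sqrrN => h1 h2.
  by rewrite ler_norml; apply/andP; split; rewrite -(ler_pM2l d0); lra.
have qqn : `|q - qn| <= b * (K * d).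
  have -> : q - qn = rinner (A v) (A (u - u_ n)).
    by rewrite /q /qn linear_subE // rinnerBr; lra.
  apply: le_trans (cauchy_schwarz _ _) _; rewrite ler_wpM2l //.
  apply: le_trans (AK _) _; rewrite ler_wpM2l // hdistC ltW //.
rewrite -[q](subrK qn); apply: le_trans (ler_normD _ _) _.
by move: qqn qn_d; lra.
Qed.

End Representation.

Section Operators.
Context {R : realType} {s : scalar_kind}.
Implicit Types X Y Z : hilbertType R s.

Lemma bounded_op_comp X Y Z (A : X -> Y) (B : Y -> Z) :
  bounded_op A -> bounded_op B -> bounded_op (B \o A).
Proof.
move=> [K K0 AK] [M M0 BM]; exists (M * K); first exact: mulr_ge0.
move=> x; rewrite /= -mulrA; apply: le_trans (BM _) _.
by rewrite ler_wpM2l.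
Qed.

Lemma linear_comp X Y Z (A : X -> Y) (B : Y -> Z) :
  linear A -> linear B -> linear (B \o A).
Proof. by move=> lA lB a x y /=; rewrite lA lB. Qed.

Lemma linear_sub X Y (A B : X -> Y) : linear A -> linear B -> linear (A \- B).
Proof.
move=> lA lB a x y /=; rewrite lA lB scalerBr opprD.
by rewrite addrACA.
Qed.

Lemma bounded_op_sub X Y (A B : X -> Y) :
  bounded_op A -> bounded_op B -> bounded_op (A \- B).
Proof.
move=> [K K0 AK] [M M0 BM]; exists (K + M); first exact: addr_ge0.
by move=> x; rewrite mulrDl; apply: le_trans (hnormB _ _) _; rewrite lerD.
Qed.

Lemma opnorm_sup X Y (A : X -> Y) : bounded_op A ->
  has_sup [set hnorm (A x) | x in [set x : X | hnorm x <= 1]].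
Proof.
move=> [K K0 AK]; split.
  by exists (hnorm (A 0)), 0 => //=; rewrite hnorm0.
by exists K => _ [x /= x1 <-]; apply: le_trans (AK _) _; rewrite ler_piMr.
Qed.

Lemma opnorm_ge0 X Y (A : X -> Y) : bounded_op A -> 0 <= opnorm A.
Proof.
move=> bA; apply: le_trans (hnorm_ge0 (A 0)) _.
apply: ub_le_sup; first exact: (opnorm_sup bA).2.
by exists 0 => //=; rewrite hnorm0.
Qed.

Lemma opnormP X Y (A : X -> Y) x : linear A -> bounded_op A ->
  hnorm (A x) <= opnorm A * hnorm x.
Proof.
move=> lA bA; have [->|x0] := eqVneq x 0.
  by rewrite linear_zeroE // !hnorm0 mulr0.
have xp : 0 < hnorm x by rewrite hnorm_gt0.
rewrite -ler_pdivrMr // mulrC; apply: ub_le_sup; first exact: (opnorm_sup bA).2.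
have ip : 0 <= (hnorm x)^-1 by rewrite invr_ge0.
exists (rscale (hnorm x)^-1 x); rewrite /= ?linear_rscaleE // hnorm_rscale.
  by rewrite ger0_norm // mulVf // gt_eqF.
by rewrite ger0_norm.
Qed.

Lemma opnorm_leP X Y (A : X -> Y) M x : linear A -> bounded_op A ->
  opnorm A <= M -> hnorm (A x) <= M * hnorm x.
Proof.
by move=> lA bA AM; apply: le_trans (opnormP _ lA bA) _; rewrite ler_wpM2r.
Qed.

Lemma opinvE X Y (A : X -> Y) (G : Y -> X) :
  cancel A G -> cancel G A -> opinv A = G.
Proof.
move=> AG GA; apply/funext => y; rewrite /opinv; case: xgetP => [x _ /= <-|].
  by rewrite AG.
by move/(_ (G y)); rewrite /= GA.
Qed.

Lemma op_invertibleP X Y (A : X -> Y) : op_invertible A ->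
  [/\ linear A /\ bounded_op A, linear (opinv A) /\ bounded_op (opinv A),
      cancel A (opinv A) & cancel (opinv A) A].
Proof.
move=> [lA cA [G [lG cG AG GA]]].
by rewrite (opinvE AG GA); split=> //; split=> //; exact: continuous_bounded_op.
Qed.

Lemma op_invertible_of_bounded X Y (A : X -> Y) (G : Y -> X) :
  linear A -> bounded_op A -> bounded_op G -> cancel A G -> cancel G A ->
  op_invertible A.
Proof.
move=> lA bA bG AG GA.
have lG : linear G.
  by move=> a x y; apply: (can_inj AG); rewrite GA lA !GA.
by split=> //; [|exists G; split=> //]; exact: bounded_op_continuous.
Qed.

(** The Riesz theorem represents the functional [v |-> Re <A v, y>]. Applying it to all multiples
    [c *: x] turns equality of real parts into equality of inner products. *)
Lemma adjointP X Y (A : X -> Y) : linear A -> bounded_op A ->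
  forall x y, inner Y (A x) y = inner X x (adjoint A y).
Proof.
move=> lA [K K0 AK] x y; move: x.
apply: (@xgetPex _ 0 [set u : X | forall x, inner Y (A x) y = inner X x u]).
have [u _ hu] : exists2 u : X, setT u &
    forall v, setT v -> rinner v u = rinner (A v) y.
  apply: (@subspace_representation _ _ _ _ setT id 1 (K * hnorm y)
           (fun x => rinner (A x) y)) => //.
  - by exists 1 => // x; rewrite mul1r.
  - by move=> v _; rewrite mul1r.
  - by move=> v w; rewrite linear_addE // rinnerDl.
  - by move=> a v; rewrite linear_rscaleE // rinnerZl.
  - exact: mulr_ge0.
  - move=> v; apply: le_trans (rinner_le _ _) _.
    by rewrite mulrAC ler_wpM2r.
exists u => x; apply: scalar_re_ext => c.
rewrite -!innerZl -linear_scaleE //.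
by have := hu (c *: x) I.
Qed.

Lemma radjointP X Y (A : X -> Y) : linear A -> bounded_op A ->
  forall x y, rinner (A x) y = rinner x (adjoint A y).
Proof. by move=> lA bA x y; rewrite /rinner adjointP. Qed.

Lemma adjoint_linear X Y (A : X -> Y) :
  linear A -> bounded_op A -> linear (adjoint A).
Proof.
move=> lA bA a y z; apply: rinner_ext => x.
by rewrite /rinner -adjointP // !innerDr !innerZr !adjointP.
Qed.

Lemma adjoint_bounded X Y (A : X -> Y) :
  linear A -> bounded_op A -> bounded_op (adjoint A).
Proof.
move=> lA bA; have [K K0 AK] := bA; exists K => // y.
have [->|y0] := eqVneq (adjoint A y) 0; first by rewrite hnorm0 mulr_ge0.
have yp : 0 < hnorm (adjoint A y) by rewrite hnorm_gt0.
rewrite -(ler_pM2l yp) -expr2 -rinner_norm -radjointP //.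
apply: le_trans (rinner_le _ _) _.
by rewrite mulrA (mulrC _ K) ler_wpM2r.
Qed.

Lemma normal_linear X Y (A : X -> Y) :
  linear A -> bounded_op A -> linear (adjoint A \o A).
Proof. by move=> lA bA; apply: linear_comp => //; exact: adjoint_linear. Qed.

Lemma normal_bounded X Y (A : X -> Y) :
  linear A -> bounded_op A -> bounded_op (adjoint A \o A).
Proof. by move=> lA bA; apply: bounded_op_comp => //; exact: adjoint_bounded. Qed.

(** [G y] represents [v |-> Re <v, y>] in the form [<A v, A u>], which the lower bound makes
    coercive. The same bound controls the inverse: [|G y|^2 <= c^2 |A (G y)|^2 = c^2 <G y, y>]. *)
Lemma normal_invertible X Y (A : X -> Y) c : linear A -> bounded_op A ->
  0 <= c -> (forall x, hnorm x <= c * hnorm (A x)) ->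
  op_invertible (adjoint A \o A).
Proof.
move=> lA bA c0 Ac; pose T := adjoint A \o A.
have [G GP] : {G : X -> X & forall y, T (G y) = y}.
  apply: (@choice _ _ (fun y u => T u = y)) => y.
  have [u _ hu] : exists2 u : X, setT u &
      forall v, setT v -> rinner (A v) (A u) = rinner v y.
    apply: (@subspace_representation _ _ _ _ setT A c (hnorm y)
             (fun x => rinner x y)) => //.
    - by move=> v w; rewrite rinnerDl.
    - by move=> a v; rewrite rinnerZl.
    - by move=> v; rewrite mulrC rinner_le.
  exists u; apply: rinner_ext => v.
  by rewrite /T /= -radjointP // hu.
have TG : cancel T G.
  move=> x; apply/eqP; rewrite -subr_eq0 -hnorm_eq0 eq_le hnorm_ge0 andbT.
  apply: le_trans (Ac _) _; set w := G (T x) - x.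
  suff /eqP : hnorm (A w) ^+ 2 = 0 by rewrite sqrf_eq0 => /eqP ->; rewrite mulr0.
  rewrite -rinner_norm radjointP // -[adjoint A (A w)]/(T w) /w.
  by rewrite linear_subE ?GP ?subrr ?rinner0r //; exact: normal_linear.
apply: (@op_invertible_of_bounded _ _ _ G) => //.
- exact: normal_linear.
- exact: normal_bounded.
exists (c ^+ 2) => [|y]; first exact: sqr_ge0.
have [->|y0] := eqVneq (G y) 0; first by rewrite hnorm0 mulr_ge0 ?sqr_ge0.
have yp : 0 < hnorm (G y) by rewrite hnorm_gt0.
rewrite -(ler_pM2l yp) -expr2.
apply: (@le_trans _ _ (c ^+ 2 * hnorm (A (G y)) ^+ 2)).
  by rewrite -exprMn ler_pXn2r ?nnegrE ?mulr_ge0.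
rewrite [leRHS]mulrCA ler_wpM2l ?sqr_ge0 //.
by rewrite -rinner_norm radjointP // [adjoint _ _]GP rinner_le.
Qed.

(* [A u] is the orthogonal projection of [y] onto the range of [A]. *)
Lemma least_squares_norm X Y (A : X -> Y) u y : linear A -> bounded_op A ->
  adjoint A (A u) = adjoint A y -> hnorm (A u) <= hnorm y.
Proof.
move=> lA bA h; have [->|y0] := eqVneq (A u) 0; first by rewrite hnorm0.
have yp : 0 < hnorm (A u) by rewrite hnorm_gt0.
rewrite -(ler_pM2l yp) -expr2 -rinner_norm radjointP // h -radjointP //.
exact: rinner_le.
Qed.

End Operators.

(** * Uniform boundedness and injective operators with closed range *)

Section ClosedRange.
Context {R : realType} {s : scalar_kind}.
Implicit Types X Y : hilbertType R s.

Lemma orthogonal_projection X (V : set X) :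
  real_subspace V -> adherent_closed V ->
  forall x, exists2 p, V p & forall v, V v -> rinner v p = rinner v x.
Proof.
move=> sV cV x.
apply: (@subspace_representation _ _ _ _ V id 1 (hnorm x)
         (fun v => rinner v x)) => //.
- by exists 1 => // v; rewrite mul1r.
- by move=> v _; rewrite mul1r.
- by move=> v w; rewrite rinnerDl.
- by move=> a v; rewrite rinnerZl.
- by move=> v; rewrite mulrC rinner_le.
Qed.

(* Gliding hump: with [|w n| > 2 n 3^(n+1)] and steps of length [3^-(n+1)] along
   [w n] whose signs avoid cancellation, the limit of the [y n] pairs with
   [w n] to more than [n]. *)
Lemma weakly_bounded_bounded Y (W : set Y) :
  (forall y, exists M, forall w, W w -> rinner y w <= M) ->
  exists C, forall w, W w -> hnorm w <= C.
Proof.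
move=> hW; apply: contrapT => hC.
(* With ratio 1/3 all steps after the [n]-th add up to at most half of it. The limit thus keeps at
   least half of the pairing [q n.+1 * |w n|], which is more than [n]. *)
pose q n : R := 3^-1 ^+ n.
have q0 n : 0 < q n by rewrite exprn_gt0.
have qS n : q n = 3 * q n.+1 by rewrite /q exprS; field.
have [w hw] : {w : nat -> Y &
    forall n, W (w n) /\ n%:R * 2 / q n.+1 < hnorm (w n)}.
  apply: (@choice _ _ (fun n w => W w /\ n%:R * 2 / q n.+1 < hnorm w)) => n.
  apply: contrapT => hn; apply: hC; exists (n%:R * 2 / q n.+1) => v Wv.
  by rewrite leNgt; apply/negP => h; apply: hn; exists v.
have w0 n : 0 < hnorm (w n).
  apply: le_lt_trans (hw n).2.
  by rewrite mulr_ge0 ?mulr_ge0 ?invr_ge0 ?(ltW (q0 _)).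
pose sg (a : R) : R := if 0 <= a then 1 else - 1.
pose step n y := y + rscale (sg (rinner y (w n)) * q n.+1 / hnorm (w n)) (w n).
pose y := nat_rect (fun=> Y) 0 step.
have yS n : hnorm (y n.+1 - y n) = q n.+1.
  rewrite /= /step addrC addKr hnorm_rscale !normrM normfV.
  rewrite (ger0_norm (hnorm_ge0 _)) (gtr0_norm (q0 _)) divfK ?gt_eqF //.
  by rewrite /sg; case: ifP; rewrite ?normrN normr1 mul1r.
have yw n : q n.+1 * hnorm (w n) <= `|rinner (y n.+1) (w n)|.
  rewrite /= /step rinnerDl rinnerZl rinner_norm.
  set b := rinner _ _.
  have -> : sg b * q n.+1 / hnorm (w n) * hnorm (w n) ^+ 2 =
            sg b * (q n.+1 * hnorm (w n)).
    by field; rewrite gt_eqF.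
  have : 0 <= q n.+1 * hnorm (w n) by rewrite mulr_ge0 // ltW.
  move: (_ * hnorm _) => z z0; rewrite /sg; case: ifPn => [b0|].
    by rewrite mul1r ger0_norm ?addr_ge0 // lerDr.
  by rewrite -ltNge => b0; rewrite mulN1r ltr0_norm; lra.
(* Telescoping sum, since [q n.+1 = (q n - q n.+1) / 2]. *)
have ydist n k : hnorm (y (n + k)%N - y n) <= (q n - q (n + k)%N) / 2.
  elim: k => [|k IH]; first by rewrite addn0 !subrr hnorm0 mul0r.
  rewrite addnS; apply: le_trans (hnorm_triangle _ (y (n + k)%N) _) _.
  by rewrite yS; have := qS (n + k)%N; move: IH; lra.
have ydist' n m : (n <= m)%N -> hnorm (y m - y n) <= q n / 2.
  move=> nm; rewrite -(subnKC nm); apply: le_trans (ydist _ _) _.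
  by have := q0 (n + (m - n))%N; lra.
have q_small e : 0 < e -> exists N, forall n, (N <= n)%N -> q n < e.
  move=> e0.
  have /cvgrPdist_lt /(_ e e0) [N _ hN] :
      (fun n => (3^-1 : R) ^+ n) @ \oo --> (0 : R).
    by apply: cvg_expr; rewrite ger0_norm ?invr_ge0 // invf_lt1 // ltr1n.
  exists N => n /hN /=; rewrite sub0r normrN.
  by rewrite ger0_norm ?exprn_ge0 ?invr_ge0.
have [l hl] : exists l, forall e, 0 < e -> exists N, forall n, (N <= n)%N ->
    hnorm (y n - l) < e.
  apply: hcomplete => e e0; have [N hN] := q_small _ e0.
  exists N => n m Nn Nm; apply: le_lt_trans (hnorm_triangle _ (y N) _) _.
  rewrite (hdistC (y N)).
  have := ydist' _ _ Nn; have := ydist' _ _ Nm; have := hN N (leqnn N); lra.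
have ly n : hnorm (l - y n) <= q n / 2.
  rewrite -subr_le0; apply: (@le0_of_small_multiples _ _ 1) => // e e0.
  have [N hN] := hl e e0.
  have := hN _ (leq_maxr n N); have := ydist' _ _ (leq_maxl n N).
  have := hnorm_triangle l (y (maxn n N)) (y n).
  by rewrite (hdistC l (y (maxn n N))); lra.
have [M hM] := hW l; have [M' hM'] := hW (- l).
have big n : n%:R <= Num.max M M'.
  have [Ww wn] := hw n.
  have lM : `|rinner l (w n)| <= Num.max M M'.
    have := hM _ Ww; have := hM' _ Ww; rewrite rinnerNl => h1 h2.
    by rewrite ler_norml lerNl !le_max h1 h2 orbT.
  apply: le_trans lM.
  have := cauchy_schwarz (l - y n.+1) (w n); rewrite rinnerBl.
  have lyw : hnorm (l - y n.+1) * hnorm (w n) <= q n.+1 / 2 * hnorm (w n).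
    by rewrite ler_wpM2r.
  move=> /le_trans/(_ lyw).
  have := lerB_dist (rinner (y n.+1) (w n)) (rinner l (w n)).
  rewrite (distrC (rinner l _)).
  have := yw n; move: wn; rewrite ltr_pdivrMr //; lra.
have := archi_boundP (le_trans (ler0n _ _) (big 0%N)).
by rewrite ltNge big.
Qed.

Definition hclosure X (V : set X) : set X :=
  [set l | forall e, 0 < e -> exists2 v, V v & hnorm (l - v) < e].

Lemma hclosure_closed X (V : set X) : adherent_closed (hclosure V).
Proof.
move=> l hl e e0; have e2 : 0 < e / 2 by rewrite divr_gt0.
have [v /(_ _ e2)[u Vu vu] lv] := hl _ e2; exists u => //.
by apply: le_lt_trans (hnorm_triangle _ v _) _; lra.
Qed.

Lemma hclosure_subspace X (V : set X) :
  real_subspace V -> real_subspace (hclosure V).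
Proof.
move=> [V0 VD VZ]; split.
- by move=> e e0; exists 0; rewrite ?subrr ?hnorm0.
- move=> x y hx hy e e0; have e2 : 0 < e / 2 by rewrite divr_gt0.
  have [v Vv xv] := hx _ e2; have [w Vw yw] := hy _ e2.
  exists (v + w); first exact: VD.
  rewrite opprD addrACA; apply: le_lt_trans (hnormD _ _) _; lra.
- move=> a x hx e e0; have a1 : 0 < `|a| + 1 by rewrite ltr_wpDl.
  have [v Vv xv] := hx _ (divr_gt0 e0 a1); exists (rscale a v); first exact: VZ.
  rewrite -rscaleBr hnorm_rscale.
  rewrite ltr_pdivlMr // in xv; apply: le_lt_trans xv.
  by rewrite mulrC ler_wpM2l // lerDl.
Qed.

Lemma range_subspace X Y (A : X -> Y) : linear A -> real_subspace (range A).
Proof.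
move=> lA; split; first by exists 0; rewrite ?linear_zeroE.
- by move=> _ _ [x _ <-] [y _ <-]; exists (x + y); rewrite ?linear_addE.
- by move=> a _ [x _ <-]; exists (rscale a x); rewrite ?linear_rscaleE.
Qed.

(** Argument by duality. Since [P y = A x] for some [x], one has
    [<y, P w> = <A x, w> = <x, A' w> <= |x|] whenever [|A' w| <= 1]; uniform boundedness gives
    [|P w| <= C] for all such [w]. Approximating [x] by some [A' w] then makes [|x|^2] nearly
    [<A x, w> = <A x, P w>], which is at most about [C |x| |A x|]. *)
Lemma injective_closed_range X Y (A : X -> Y) : linear A -> bounded_op A ->
  injective A -> adherent_closed (range A) ->
  exists2 c, 0 <= c & forall x, hnorm x <= c * hnorm (A x).
Proof.
move=> lA bA iA cA; pose A' := adjoint A.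
have lA' : linear A' by exact: adjoint_linear.
have [P hP] : {P : Y -> Y & forall y, range A (P y) /\
    forall v, (range A) v -> rinner v (P y) = rinner v y}.
  apply: (@choice _ _ (fun y p => range A p /\
    forall v, (range A) v -> rinner v p = rinner v y)) => y.
  by have [p Vp hp] := orthogonal_projection (range_subspace lA) cA y; exists p.
have [C hC] : exists C, forall w,
    [set P w | w in [set w | hnorm (A' w) <= 1]] w -> hnorm w <= C.
  apply: weakly_bounded_bounded => y.
  have [[x _ xy] hy] := hP y; exists (hnorm x) => _ [w /= w1 <-].
  rewrite rinnerC -hy; last exact: (hP w).1.
  rewrite rinnerC -xy (hP w).2; last by exists x.
  rewrite radjointP //; apply: le_trans (rinner_le _ _) _.
  by rewrite ler_piMr.
have C0 : 0 <= C.
  apply: le_trans (hnorm_ge0 (P 0)) _; apply: hC; exists 0 => //=.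
  by rewrite linear_zeroE // hnorm0 ler01.
exists C => // x.
pose V := hclosure (range A').
have [p Vp hp] := orthogonal_projection
  (hclosure_subspace (range_subspace lA')) (@hclosure_closed _ _) x.
(* The range of [A'] is dense: [x - p] is orthogonal to it, so [A p = A x], and [A] is injective. *)
have px : p = x.
  apply: iA; apply: rinner_ext => w; rewrite rinnerC (rinnerC w).
  rewrite !radjointP // !(rinnerC _ (adjoint A w)); apply: hp => e e0.
  by exists (A' w); rewrite ?subrr ?hnorm0 //; exists w.
have [->|x0] := eqVneq x 0; first by rewrite hnorm0 mulr_ge0.
have xp : 0 < hnorm x by rewrite hnorm_gt0.
rewrite -subr_le0 -(pmulr_rle0 _ xp).
apply: (@le0_of_small_multiples _ _ (hnorm x + C * hnorm (A x))).
  by rewrite addr_ge0 ?mulr_ge0.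
move=> e e0; have := Vp; rewrite px => /(_ e e0)[_ [w _ <-] xw].
have xx : hnorm x * hnorm x = rinner x (x - A' w) + rinner (A x) w.
  by rewrite rinnerBr -radjointP // -expr2 -rinner_norm; ring.
have h1 : rinner x (x - A' w) <= hnorm x * e.
  by apply: le_trans (rinner_le _ _) _; rewrite ler_wpM2l ?ltW.
(* [m] bounds [|A' w|], so [w / m] is in the set on which [|P w| <= C]. *)
pose m := hnorm x + e; have m0 : 0 < m by rewrite addr_gt0.
have A'w : hnorm (A' w) <= m.
  rewrite -[A' w](subKr x) opprB; apply: le_trans (hnormD _ _) _.
  by rewrite hdistC /m lerD2l ltW.
have h2 : rinner (A x) w <= m * (hnorm (A x) * C).
  have -> : w = rscale m (rscale m^-1 w).
    by rewrite rscaleA divff ?gt_eqF // rscale1.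
  rewrite rinnerZr; apply: ler_wpM2l; first exact: ltW.
  rewrite -(hP _).2; last by exists x.
  apply: le_trans (rinner_le _ _) _; rewrite ler_wpM2l //.
  apply: hC; exists (rscale m^-1 w) => //=.
  rewrite linear_rscaleE // hnorm_rscale gtr0_norm ?invr_gt0 //.
  by rewrite ler_pdivrMl // mulr1.
rewrite mulrBr xx; move: h1 h2; rewrite /m; lra.
Qed.

End ClosedRange.

(** * The majorant function and its scalar sequence *)

Section DefiniteIntegral.
Context {R : realType}.
Implicit Types (f g L : R -> R) (a b x : R).
Local Notation mu := (@lebesgue_measure R).

Definition integrable_cc f a b := mu.-integrable `[a, b] (EFin \o f).

Lemma defint_split f a b x : a <= x -> x <= b -> integrable_cc f a b ->
  defint a b f = defint a x f + defint x b f.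
Proof.
move=> ax xb fab; rewrite addrC; apply: (canRL (subrK _)).
rewrite /defint Rintegral_itvB ?bnd_simp // Rintegral_itv_obnd_cbnd //.
by apply: integrableS fab => //; apply: subset_itvr; rewrite bnd_simp.
Qed.

Lemma defint_le f g a b : integrable_cc f a b -> integrable_cc g a b ->
  (forall x, a <= x <= b -> f x <= g x) -> defint a b f <= defint a b g.
Proof.
by move=> fi gi fg; exact: le_Rintegral.
Qed.

Lemma defint_ge0 f a b : (forall x, a <= x <= b -> 0 <= f x) ->
  0 <= defint a b f.
Proof. by move=> h; apply: Rintegral_ge0 => x /=; rewrite in_itv /=; exact: h. Qed.

(** A zero integral would make [f] vanish almost everywhere, and the whole interval, of positive
    length, would lie in a null set. *)
Lemma defint_gt0 f a b : a < b -> integrable_cc f a b ->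
  (forall x, a <= x <= b -> 0 < f x) -> 0 < defint a b f.
Proof.
move=> ab fi f0; rewrite lt_neqAle defint_ge0 ?andbT; last first.
  by move=> x /f0/ltW.
apply/eqP => i0.
have mf := measurable_int _ fi.
have : (\int[mu]_(x in `[a, b]) `|(EFin \o f) x| = 0)%E.
  transitivity (\int[mu]_(x in `[a, b]) (f x)%:E)%E.
    apply: eq_integral => x; rewrite inE /= in_itv /= => /f0 fx.
    by rewrite /= ger0_norm // ltW.
  have fin : (\int[mu]_(x in `[a, b]) (f x)%:E)%E \is a fin_num.
    exact: (@integrable_fin_num _ _ _ mu _ _ _ fi).
  by rewrite -(fineK fin) -[X in X%:E]/(defint a b f) -i0.
move=> /(@ae_eq_integral_abs _ _ _ mu _ _ _ mf) [//|N [mN N0 hN]].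
have : (mu `[a, b] <= mu N)%E.
  apply: le_measure; rewrite ?inE //.
  move=> x /= xab; apply: hN => /= /(_ xab) [fx].
  by move: xab; rewrite in_itv /= => /f0; rewrite fx ltxx.
by rewrite N0 lebesgue_measure_itv /= lte_fin ab -EFinD lee_fin subr_le0 leNgt ab.
Qed.

Lemma defint_xx f a : defint a a f = 0.
Proof. by rewrite /defint set_itv1 Rintegral_set1. Qed.

Lemma defintZ f a b c : integrable_cc f a b ->
  defint a b (fun x => c * f x) = c * defint a b f.
Proof. by move=> fi; rewrite /defint RintegralZl. Qed.

Lemma integrable_ccZ f a b c : integrable_cc f a b ->
  integrable_cc (fun x => c * f x) a b.
Proof. by move=> fi; by apply: (@integrableZl _ _ _ mu) fi => //. Qed.

Lemma integrable_ccM f g a b M : integrable_cc f a b ->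
  measurable_fun setT g -> (forall x, a <= x <= b -> `|g x| <= M) ->
  integrable_cc (fun x => f x * g x) a b.
Proof.
move=> fi mg gM.
apply: (@integrableMl _ _ _ mu _ _ _ _ fi) => //; first exact: measurable_funTS.
exists M; split; first exact: num_real.
move=> N MN x /= xab; apply: le_trans (ltW MN); apply: gM.
by move: xab; rewrite in_itv.
Qed.

Lemma integrable_cc_powR a b p : 0 <= a -> 0 <= p ->
  integrable_cc (fun x => x `^ p) a b.
Proof.
move=> a0 p0; apply: measurable_bounded_integrable => //.
- rewrite /= lebesgue_measure_itv /=; case: ifP => // _.
  by rewrite -EFinD ltry.
- by apply: measurable_funTS; exact: measurable_realfun.measurable_powR.
exists (b `^ p); split; first exact: num_real.
move=> N MN x /=; rewrite in_itv /= => /andP[ax xb]; apply: le_trans (ltW MN).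
have x0 := le_trans a0 ax.
by rewrite ger0_norm ?powR_ge0 // ge0_ler_powR // nnegrE (le_trans x0).
Qed.

Lemma defint_powR b p : 0 < b -> 0 <= p ->
  defint 0 b (fun x => x `^ p) = b `^ (p + 1) / (p + 1).
Proof.
move=> b0 p0; have p1 : 0 < p + 1 by rewrite ltr_wpDl.
have cvg0 q : 0 < q -> (x `^ q @[x --> 0^'+] --> (0 `^ q : R))%classic.
  by move=> q0; rewrite powR0 ?gt_eqF //; exact: powR_cvg0.
have cpow q x : 0 < x -> {for x, continuous (fun x : R => x `^ q)}.
  move=> x0; apply: differentiable_continuous; apply/derivable1_diffP.
  by apply: derivable_powR; rewrite in_itv /= x0.
pose F x : R := (p + 1)^-1 * x `^ (p + 1).
have := @continuous_FTC2 R (fun x => x `^ p) F 0 b b0 _ _ _.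
rewrite /defint /Rintegral => -> /=.
- by rewrite /F powR0 ?gt_eqF // mulr0 subr0 mulrC.
- apply/(continuous_within_itvP _ b0); split.
  + by move=> x; rewrite in_itv /= => /andP[x0 _]; exact: cpow.
  (* For [p = 0] the integrand is the constant 1, also at 0 where the library sets the zeroth power
     of 0 to 1. The limit at 0 then differs from the one for [p > 0]. *)
  + have [->|pn0] := eqVneq p 0.
      rewrite powRr0; under eq_fun do rewrite powRr0; exact: cvg_cst.
    by apply: cvg0; rewrite lt_neqAle eq_sym pn0.
  + by apply: cvg_at_left_filter; exact: cpow.
- split.
  + move=> x; rewrite in_itv /= => /andP[x0 _].
    apply: derivableM => //; apply: derivable_powR; by rewrite in_itv /= x0.
  + by apply: cvgM; [exact: cvg_cst|exact: cvg0].
  + by apply: cvgM; [exact: cvg_cst|apply: cvg_at_left_filter; exact: cpow].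
- move=> x; rewrite in_itv /= => /andP[x0 _].
  rewrite derive1Ml /=; last by apply: derivable_powR; rewrite in_itv /= x0.
  rewrite powR_derive1 ?in_itv /= ?x0 //.
  by rewrite mulKf ?gt_eqF // addrK.
Qed.

Lemma defint_continuous f b : integrable_cc f 0 b ->
  forall x e, 0 <= x <= b -> 0 < e -> exists2 d, 0 < d &
    forall y, 0 <= y <= b -> `|y - x| < d -> `|defint 0 y f - defint 0 x f| < e.
Proof.
move=> fi x e /andP[x0 xb] e0.
have := parameterized_integral_continuous (le_trans x0 xb) fi.
move=> /subspace_continuousP /(_ x).
rewrite /= in_itv /= x0 xb => /(_ isT) /cvgrPdist_lt /(_ e e0).
rewrite near_withinE => /nbhs_ballP[d /= d0 hd]; exists d => // y yb yx.
rewrite distrC; apply: hd; first by rewrite -ball_normE /= distrC.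
by rewrite /= in_itv.
Qed.

End DefiniteIntegral.

(** The supremum of the empty set is 0 by convention, so [0 <= a < sup S] forces [S] to be nonempty.
    Every radius of the theorem is opened this way. *)
Lemma lt_sup_exists (R : realType) (S : set R) a :
  0 <= a -> a < sup S -> exists2 u, S u & a < u.
Proof.
move=> a0 aS; apply: sup_gt => //; apply/set0P/eqP => S0.
by move: aS; rewrite S0 sup0 ltNge a0.
Qed.

Section Majorant.
Context {R : realType} (L : R -> R) (rad : R).
Hypothesis L_gt0 : forall u, 0 <= u < rad -> 0 < L u.
Hypothesis L_int : lebesgue_measure.-integrable `[0, rad[ (EFin \o L).

Let G a := defint 0 a L.
Let H a := defint 0 a (fun u => L u * u).

Lemma L_integrable a b : 0 <= a -> b < rad -> integrable_cc L a b.
Proof.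
move=> a0 br; apply: integrableS L_int => //.
by apply: subset_itv; rewrite bnd_simp.
Qed.

Lemma Lu_integrable a b : 0 <= a -> b < rad ->
  integrable_cc (fun u => L u * u) a b.
Proof.
move=> a0 br; apply: (@integrable_ccM _ _ _ _ _ b) => //.
- exact: L_integrable.
- by move=> x /andP[ax xb]; rewrite ger0_norm // (le_trans a0).
Qed.

Lemma intL_sub a b : 0 <= a -> a <= b -> b < rad -> G b - G a = defint a b L.
Proof.
move=> a0 ab br; rewrite /G (@defint_split _ L 0 b a) //; last exact: L_integrable.
by rewrite addrC addKr.
Qed.

Lemma intLu_sub a b : 0 <= a -> a <= b -> b < rad ->
  H b - H a = defint a b (fun u => L u * u).
Proof.
move=> a0 ab br; rewrite /H (@defint_split _ _ 0 b a) //; last exact: Lu_integrable.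
by rewrite addrC addKr.
Qed.

Lemma intL_le a b : 0 <= a -> a <= b -> b < rad -> G a <= G b.
Proof.
move=> a0 ab br; rewrite -subr_ge0 intL_sub //; apply: defint_ge0 => x /andP[ax xb].
by rewrite ltW // L_gt0 // (le_trans a0) //= (le_lt_trans xb).
Qed.

(** Integrate [a L(u) <= L(u) u <= b L(u)]. Monotonicity and positivity of [H], the bound
    [H t <= t G t] and the increment inequality for the primitive are all drawn from this. *)
Lemma intLu_bounds a b : 0 <= a -> a <= b -> b < rad ->
  a * (G b - G a) <= H b - H a <= b * (G b - G a).
Proof.
move=> a0 ab br; rewrite intL_sub // intLu_sub //.
have iL := L_integrable a0 br; have iLu := Lu_integrable a0 br.
rewrite -!defintZ //; apply/andP; split; apply: defint_le => //;
  try exact: integrable_ccZ; move=> x /andP[ax xb]; rewrite mulrC.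
1: rewrite ler_wpM2l //.
2: rewrite ler_wpM2r //.
all: by rewrite ltW // L_gt0 // (le_trans a0) //= (le_lt_trans xb).
Qed.

Lemma intL0 : G 0 = 0. Proof. exact: defint_xx. Qed.
Lemma intLu0 : H 0 = 0. Proof. exact: defint_xx. Qed.

Lemma intLu_le a b : 0 <= a -> a <= b -> b < rad -> H a <= H b.
Proof.
move=> a0 ab br; rewrite -subr_ge0; have /andP[+ _] := intLu_bounds a0 ab br.
by apply: le_trans; rewrite mulr_ge0 // subr_ge0 intL_le.
Qed.

Lemma intLu_le_intL a : 0 <= a -> a < rad -> H a <= a * G a.
Proof.
move=> a0 ar; have := intLu_bounds (lexx 0) a0 ar.
by rewrite intL0 intLu0 !subr0 => /andP[].
Qed.

Lemma intLu_ge0 a : 0 <= a -> a < rad -> 0 <= H a.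
Proof. by move=> a0 ar; rewrite -intLu0 intLu_le. Qed.

Lemma intLu_gt0 a : 0 < a -> a < rad -> 0 < H a.
Proof.
move=> a0 ar; have h0 : 0 < a / 2 by rewrite divr_gt0.
have ha : a / 2 < a by rewrite ltr_pdivrMr // ltr_pMr // ltr1n.
(* The lower bound of [intLu_bounds] degenerates at the left endpoint 0, so only the right half of
   the interval is kept. *)
apply: (@lt_le_trans _ _ (H a - H (a / 2))).
  have /andP[+ _] := intLu_bounds (ltW h0) (ltW ha) ar; apply: lt_le_trans.
  rewrite mulr_gt0 // intL_sub ?ltW //; apply: defint_gt0 => //.
    by apply: L_integrable => //; exact: ltW.
  move=> x /andP[xa xb]; rewrite L_gt0 // (le_lt_trans xb ar) andbT.
  exact: le_trans (ltW h0) xa.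
by rewrite gerBl intLu_ge0 // ?(ltW h0) // (lt_trans ha).
Qed.

(* The function [s |-> s (G e - G s) + H s] is a primitive of [G e - G]; it takes
   the place of a Fubini exchange in [int_0^1 int_(tau e)^e L]. *)
Lemma majorant_increment e x y : 0 <= x -> x <= y -> y <= e -> e < rad ->
  (y - x) * (G e - G y) <=
    (y * (G e - G y) + H y) - (x * (G e - G x) + H x).
Proof.
move=> x0 xy ye er; have /andP[+ _] := intLu_bounds x0 xy (le_lt_trans ye er).
by lra.
Qed.

Lemma intL_continuous b : b < rad -> forall x e, 0 <= x <= b -> 0 < e ->
  exists2 d, 0 < d &
    forall y, 0 <= y <= b -> `|y - x| < d -> `|G y - G x| < e.
Proof. by move=> br; apply: defint_continuous; exact: L_integrable. Qed.

Lemma intLu_continuous b : b < rad -> forall x e, 0 <= x <= b -> 0 < e ->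
  exists2 d, 0 < d &
    forall y, 0 <= y <= b -> `|y - x| < d -> `|H y - H x| < e.
Proof. by move=> br; apply: defint_continuous; exact: Lu_integrable. Qed.

Lemma lt_nu_bar a : 0 <= a -> a < nu_bar L rad -> a < rad /\ G a < 1.
Proof.
move=> a0 /(lt_sup_exists a0)[u [/andP[u0 ur] Gu] au].
split; first exact: lt_trans ur.
by apply: le_lt_trans (intL_le a0 (ltW au) ur) _; rewrite -subr_lt0.
Qed.

(** Write [L u * u = g u * u^p] with [g u = u^(1-p) L u] nondecreasing and [c = g a]. Then [g <= c]
    below [a] and [g >= c] above it, so both [H a] and [H b - H a] compare with [c] times integrals
    of [u^p]. *)
Lemma powR_ratio_le p a b : 0 <= p -> 0 < a -> a <= b -> b < nu_bar L rad ->
  {in `]0, nu_bar L rad[ &, {homo (fun u => u `^ (1 - p) * L u) :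
     u v / u <= v}} ->
  H a / a `^ (p + 1) <= H b / b `^ (p + 1).
Proof.
move=> p0 a0 ab bn Lmono; have b0 := lt_le_trans a0 ab.
have [br Gb] := lt_nu_bar (ltW b0) bn; have ar := le_lt_trans ab br.
pose c := a `^ (1 - p) * L a.
have c0 : 0 <= c by rewrite mulr_ge0 ?powR_ge0 // ltW // L_gt0 // ltW.
have LuE u : 0 < u -> L u * u = u `^ (1 - p) * L u * u `^ p.
  move=> u0; rewrite mulrAC -powRD; last by rewrite (gt_eqF u0) implybT.
  by rewrite subrK powRr1 ?ltW // mulrC.
have p1 : 0 < p + 1 by rewrite ltr_wpDl.
pose J x := defint 0 x (fun u => u `^ p).
have Ha : H a <= c * J a.
  rewrite -defintZ; last exact: integrable_cc_powR.
  apply: defint_le; [exact: Lu_integrable| |].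
    by apply: integrable_ccZ; exact: integrable_cc_powR.
  (* Monotonicity of [g] is assumed on an open interval only, so [u = 0] is treated apart. *)
  move=> u /andP[u0 ua]; have [->|un0] := eqVneq u 0.
    by rewrite mulr0 mulr_ge0 ?powR_ge0.
  have up : 0 < u by rewrite lt_neqAle eq_sym un0.
  rewrite LuE // ler_wpM2r ?powR_ge0 //; apply: Lmono => //.
    by rewrite in_itv /= up (le_lt_trans (le_trans ua ab)).
  by rewrite in_itv /= a0 (le_lt_trans ab).
have Hb : c * (J b - J a) <= H b - H a.
  have JE : J b - J a = defint a b (fun u => u `^ p).
    rewrite /J (@defint_split _ _ 0 b a) // ?(ltW a0) //.
      by rewrite addrC addKr.
    exact: integrable_cc_powR.
  rewrite JE intLu_sub ?(ltW a0) // -defintZ; last first.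
    by apply: integrable_cc_powR => //; exact: ltW.
  apply: defint_le.
  - by apply: integrable_ccZ; apply: integrable_cc_powR => //; exact: ltW.
  - by apply: Lu_integrable => //; exact: ltW.
  move=> u /andP[au ub]; have up := lt_le_trans a0 au.
  rewrite LuE // ler_wpM2r ?powR_ge0 //; apply: Lmono => //.
    by rewrite in_itv /= a0 (le_lt_trans ab).
  by rewrite in_itv /= up (le_lt_trans ub).
move: Ha Hb; rewrite /J !defint_powR //.
have A0 : 0 < a `^ (p + 1) by rewrite powR_gt0.
have B0 : 0 < b `^ (p + 1) by rewrite powR_gt0.
have AB : a `^ (p + 1) <= b `^ (p + 1).
  by rewrite ge0_ler_powR // ?nnegrE ltW.
move=> Ha Hb; rewrite ler_pdivrMr // mulrAC ler_pdivlMr //.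
move: (a `^ (p + 1)) (b `^ (p + 1)) A0 B0 AB Ha Hb => A B A0 B0 AB.
pose k := c / (p + 1).
have kE z : c * (z / (p + 1)) = k * z by rewrite /k; ring.
rewrite mulrBr !kE => Ha Hb.
have BA : 0 <= B - A by rewrite subr_ge0.
(* [H a (B - A) <= k A (B - A) <= A (H b - H a)], that is, [H a B <= H b A]. *)
have h1 := ler_wpM2r BA Ha; have h2 := ler_wpM2l (ltW A0) Hb.
by move: h1 h2; lra.
Qed.

End Majorant.

Section MajorantSequence.
Context {R : realType} (L : R -> R) (rad th w1 w2 : R).
Hypothesis L_gt0 : forall u, 0 <= u < rad -> 0 < L u.
Hypothesis L_int : lebesgue_measure.-integrable `[0, rad[ (EFin \o L).
Hypotheses (th_ge0 : 0 <= th) (w1_gt0 : 0 < w1) (w2_ge0 : 0 <= w2).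

Let G a := defint 0 a L.
Let H a := defint 0 a (fun u => L u * u).
Let rho := rho_bar L rad th w1 w2.

Definition majorant_step t :=
  (1 + th) * w1 * H t / (1 - G t) + (w1 * th + w2) * t.

Let c1_gt0 : 0 < (1 + th) * w1.
Proof. by rewrite mulr_gt0 // ltr_wpDr. Qed.

Let c_ge0 : 0 <= w1 * th + w2.
Proof. by rewrite addr_ge0 // mulr_ge0 // ltW. Qed.

Lemma lt_rho_nu t : 0 <= t -> t < rho -> t < nu_bar L rad.
Proof.
by move=> t0 /(lt_sup_exists t0)[d [/andP[_ dn] _] td]; exact: lt_trans dn.
Qed.

Lemma lt_rho t : 0 <= t -> t < rho -> t < rad /\ G t < 1.
Proof. by move=> t0 tr; apply: lt_nu_bar => //; exact: lt_rho_nu. Qed.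

(** This is the inequality in the definition of [rho_bar], multiplied by [t]. *)
Lemma majorant_step_lt t : 0 < t -> t < rho -> majorant_step t < t.
Proof.
move=> t0 tr; have [trad Gt] := lt_rho (ltW t0) tr.
have [d [_ hd] td] := lt_sup_exists (ltW t0) tr.
have := hd t; rewrite t0 td => /(_ isT).
have G1 : 0 < 1 - G t by rewrite subr_gt0.
rewrite -(ltr_pM2r t0) mul1r; apply: le_lt_trans.
rewrite /majorant_step le_eqVlt; apply/orP; left; apply/eqP.
rewrite -/(G t) -/(H t); field.
by rewrite !gt_eqF.
Qed.

Lemma majorant_step0 : majorant_step 0 = 0.
Proof. by rewrite /majorant_step /H defint_xx !mulr0 mul0r addr0. Qed.

Lemma majorant_step_le t : 0 <= t -> t < rho -> majorant_step t <= t.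
Proof.
rewrite le_eqVlt => /predU1P[<- _|t0 /(majorant_step_lt t0)/ltW //].
by rewrite majorant_step0.
Qed.

Lemma majorant_step_gt0 t : 0 < t -> t < rho -> 0 < majorant_step t.
Proof.
move=> t0 tr; have [trad Gt] := lt_rho (ltW t0) tr.
rewrite ltr_wpDr //; first exact: (mulr_ge0 c_ge0 (ltW t0)).
by rewrite divr_gt0 ?subr_gt0 // mulr_gt0 //; exact: (intLu_gt0 L_gt0 L_int).
Qed.

Lemma majorant_step_mono a b : 0 <= a -> a <= b -> b < rho ->
  majorant_step a <= majorant_step b.
Proof.
move=> a0 ab br; have b0 := le_trans a0 ab; have [brad Gb] := lt_rho b0 br.
have Gab : G a <= G b by exact: (intL_le L_gt0 L_int).
rewrite lerD ?ler_wpM2l //.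
have Hab : H a <= H b by exact: (intLu_le L_gt0 L_int).
have Ga : 0 < 1 - G a by rewrite subr_gt0 (le_lt_trans Gab).
apply: ler_pM.
- by apply: mulr_ge0; [exact: ltW|apply: (intLu_ge0 L_gt0 L_int) => //; exact: le_lt_trans brad].
- by rewrite invr_ge0 ltW.
- by rewrite ler_wpM2l // ltW.
- by rewrite lef_pV2 ?posrE ?Ga ?subr_gt0 // lerB.
Qed.

(** Both bounds have the same limit as [t] tends to 0, because [G] is continuous and [G 0 = 0]. The
    upper one yields the limsup for the iterates, the pair yields the limit for the scalar
    sequence. *)
Lemma majorant_step_bounds t : 0 < t -> t < rho ->
  w1 * th + w2 <= majorant_step t / t <=
  (1 + th) * w1 * (G t / (1 - G t)) + (w1 * th + w2).
Proof.
move=> t0 tr; have [trad Gt] := lt_rho (ltW t0) tr.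
have G1 : 0 < 1 - G t by rewrite subr_gt0.
have Ht0 : 0 <= H t by apply: (intLu_ge0 L_gt0 L_int) => //; exact: ltW.
apply/andP; split.
  rewrite ler_pdivlMr // lerDr divr_ge0 ?(ltW G1) //.
  exact: mulr_ge0 (ltW c1_gt0) Ht0.
rewrite ler_pdivrMr // [leRHS]mulrDl lerD2r -[leLHS]mulrA -[leRHS]mulrA.
rewrite ler_wpM2l ?(ltW c1_gt0) //.
rewrite [leRHS]mulrAC ler_wpM2r ?invr_ge0 ?(ltW G1) // mulrC.
by apply: (intLu_le_intL L_gt0 L_int) => //; exact: ltW.
Qed.

Lemma intL_cvg b (u : nat -> R) l : b < rad -> (forall n, 0 <= u n <= b) ->
  0 <= l <= b -> u @ \oo --> l -> G (u n) @[n --> \oo] --> G l.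
Proof.
move=> br ub lb ul; apply/cvgrPdist_lt => e e0.
have [d d0 hd] := intL_continuous L_int br lb e0.
have /cvgrPdist_lt /(_ d d0) := ul; apply: filterS => n /=.
by rewrite distrC => /(hd _ (ub n)); rewrite distrC.
Qed.

Lemma intLu_cvg b (u : nat -> R) l : b < rad -> (forall n, 0 <= u n <= b) ->
  0 <= l <= b -> u @ \oo --> l -> H (u n) @[n --> \oo] --> H l.
Proof.
move=> br ub lb ul; apply/cvgrPdist_lt => e e0.
have [d d0 hd] := intLu_continuous L_int br lb e0.
have /cvgrPdist_lt /(_ d d0) := ul; apply: filterS => n /=.
by rewrite distrC => /(hd _ (ub n)); rewrite distrC.
Qed.

(* A positive limit [l] would satisfy [l <= majorant_step l < l]. *)
Lemma majorized_cvg0 (e : nat -> R) : (forall n, 0 <= e n) -> e 0%N < rho ->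
  (forall n, e n < rho -> e n.+1 <= majorant_step (e n)) ->
  (forall n, e n <= e 0%N) /\ e @ \oo --> (0 : R).
Proof.
move=> e0 er es.
have e_lt n : e n < rho.
  elim: n => // n IH; apply: (le_lt_trans _ IH); apply: le_trans (es _ IH) _.
  exact: majorant_step_le.
have e_dec n : e n.+1 <= e n.
  by apply: le_trans (es _ (e_lt n)) _; exact: majorant_step_le.
have e_noninc : nonincreasing_seq e by exact/nonincreasing_seqP.
have e_le n : e n <= e 0%N by exact: e_noninc.
split=> //.
have e_lb : has_lbound (range e) by exists 0 => _ [n _ <-].
have := nonincreasing_cvgn e_noninc e_lb; set l := inf _ => el.
have l0 : 0 <= l.
  by apply: lb_le_inf => [|_ [n _ <-] //]; exists (e 0%N), 0%N.
have l_le n : l <= e n by apply: ge_inf => //; exists n.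
have lr : l < rho by exact: le_lt_trans (l_le 0%N) er.
move: (l0); rewrite le_eqVlt => /predU1P[l_0|l_gt0]; first by rewrite [X in _ --> X]l_0.
have [brad _] := lt_rho (e0 0%N) er; have [_ Gl] := lt_rho l0 lr.
have e_in n : 0 <= e n <= e 0%N by rewrite e0 e_le.
have l_in : 0 <= l <= e 0%N by rewrite l0 l_le.
have Ml : majorant_step (e n) @[n --> \oo] --> majorant_step l.
  apply: cvgD; last exact: cvgMr.
  apply: cvgM; first by apply: cvgMr; exact: intLu_cvg brad e_in l_in el.
  apply: cvgV; first by rewrite gt_eqF // subr_gt0.
  by apply: cvgB; [exact: cvg_cst|exact: intL_cvg brad e_in l_in el].
have : l <= majorant_step l.
  apply: (@ler_cvg_to _ _ _ _ (fun n => e n.+1) _ _ _ _ Ml).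
    by rewrite (cvg_shiftS e).
  by apply: nearW => n; exact: es.
by rewrite leNgt majorant_step_lt.
Qed.

End MajorantSequence.

(** * Linearization error and the inexact step *)

Section OneStep.
Context {R : realType} {s : scalar_kind}.
Implicit Types X Y : hilbertType R s.

Lemma subr_cancel_common (V : zmodType) (a b u v w : V) :
  (a - u) - (b - v) = (a - b - w) - ((u - v) - w).
Proof.
rewrite (opprB (u - v) w) addrA subrK !opprB addrACA [RHS]addrACA.
by rewrite [- u - b]addrC.
Qed.

(** Local increment bounds with slack [e] propagate from 0 to the supremum [c] of the points they
    reach. The local hypothesis is two-sided because [c] is first reached from its left and then
    passed to its right. *)
Lemma norm_increment_le Y (phi : R -> Y) (psi : R -> R) (beta : R) :
  0 <= beta ->
  (forall t e, 0 <= t <= 1 -> 0 < e -> exists2 d, 0 < d & forall t',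
     0 <= t' <= 1 -> `|t' - t| < d ->
     (t <= t' -> beta * hnorm (phi t' - phi t) <= psi t' - psi t + e * (t' - t)) /\
     (t' <= t -> beta * hnorm (phi t - phi t') <= psi t - psi t' + e * (t - t'))) ->
  beta * hnorm (phi 1 - phi 0) <= psi 1 - psi 0.
Proof.
move=> b0 h; rewrite -subr_le0; apply: (@le0_of_small_multiples _ _ 1) => // e e0.
pose S := [set c | 0 <= c <= 1 /\
  beta * hnorm (phi c - phi 0) <= psi c - psi 0 + e * c].
have S0 : S 0 by rewrite /S /= lexx ler01 !subrr hnorm0 !mulr0 addr0.
have S_sup : has_sup S by split; [exists 0|exists 1 => c [/andP[]]].
pose c := sup S.
have c0 : 0 <= c by apply: ub_le_sup S0; exact: S_sup.2.
have c1 : c <= 1 by apply: ge_sup; [exact: S_sup.1|move=> x [/andP[]]].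
have c01 : 0 <= c <= 1 by rewrite c0.
have [d d0 hd] := h c e c01 e0.
have [c' Sc' cc'] := sup_adherent d0 S_sup; have [c'01 c'S] := Sc'.
have c'c : c' <= c by apply: ub_le_sup Sc'; exact: S_sup.2.
have tri x y z : beta * hnorm (phi x - phi z) <=
    beta * hnorm (phi x - phi y) + beta * hnorm (phi y - phi z).
  by rewrite -mulrDr ler_wpM2l // hnorm_triangle.
have Sc : S c.
  split => //; apply: le_trans (tri _ c' _) _.
  have [|_ /(_ c'c)] := hd c' c'01; last by move: c'S; lra.
  by rewrite distrC ger0_norm ?subr_ge0 // ltrBlDr -ltrBlDl.
have [c_lt1|c_ge1] := ltP c 1; last first.
  have cE : c = 1 by apply/eqP; rewrite eq_le c1.
  by have [_] := Sc; rewrite cE; lra.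
(* A point beyond [c], still within distance [d] of it and inside [[0, 1]]: it belongs to [S],
   contradicting the choice of [c]. *)
pose m := Num.min 1 (c + d / 2).
have d2 : 0 < d / 2 by rewrite divr_gt0.
have cm : c < m by rewrite lt_min c_lt1 ltrDl.
have m1 : m <= 1 by rewrite ge_min lexx.
have m01 : 0 <= m <= 1 by rewrite m1 (le_trans c0 (ltW cm)).
have md : m <= c + d / 2 by rewrite ge_min lexx orbT.
have [|/(_ (ltW cm)) hm _] := hd m m01.
  by rewrite ger0_norm ?subr_ge0 ?ltW //; lra.
suff /(ub_le_sup S_sup.2) : S m by rewrite leNgt cm.
split => //; apply: le_trans (tri _ c _) _.
by have [_] := Sc; move: hm; lra.
Qed.

Section Linearization.
Variables (X Y : hilbertType R s) (F : X -> Y) (xs : X) (kappa rad beta : R).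
Variable L : R -> R.
Hypothesis L_gt0 : forall u, 0 <= u < rad -> 0 < L u.
Hypothesis L_int : lebesgue_measure.-integrable `[0, rad[ (EFin \o L).
Hypothesis F_diff : forall z, oball xs kappa z -> differentiable F z.
Hypothesis beta_ge0 : 0 <= beta.
Hypothesis F_lip : forall (tau : R) (z : X), 0 <= tau <= 1 -> oball xs kappa z ->
  beta * opnorm ('d F z \- 'd F (xs + scalar_of_real s tau *: (z - xs)))
    <= defint (tau * hnorm (z - xs)) (hnorm (z - xs)) L.

Let G a := defint 0 a L.
Let H a := defint 0 a (fun u => L u * u).

Lemma diff_linear z : linear ('d F z). Proof. exact: linearP. Qed.

Lemma diff_bounded z : oball xs kappa z -> bounded_op ('d F z).
Proof.
move=> /F_diff dF; apply: continuous_bounded_op; first exact: diff_linear.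
exact: diff_continuous.
Qed.

Lemma oball_segment z t : oball xs kappa z -> 0 <= t <= 1 ->
  oball xs kappa (xs + rscale t (z - xs)).
Proof.
rewrite /oball /= => zk /andP[t0 t1]; rewrite addrC addKr.
rewrite hnorm_rscale ger0_norm //; apply: le_lt_trans zk.
by rewrite ler_piMl.
Qed.

Lemma diff_lip z t v : oball xs kappa z -> 0 <= t <= 1 -> hnorm (z - xs) < rad ->
  beta * hnorm ('d F z v - 'd F (xs + rscale t (z - xs)) v) <=
  (G (hnorm (z - xs)) - G (t * hnorm (z - xs))) * hnorm v.
Proof.
move=> zk t01 er; set e := hnorm (z - xs).
have /andP[t0 t1] := t01.
have te0 : 0 <= t * e by rewrite mulr_ge0 // hnorm_ge0.
have tee : t * e <= e by rewrite ler_piMl // hnorm_ge0.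
rewrite (intL_sub L_int te0 tee er).
apply: le_trans (ler_wpM2r (hnorm_ge0 v) (F_lip t01 zk)).
rewrite -mulrA ler_wpM2l //.
apply: (@opnormP _ _ _ _ ('d F z \- 'd F (xs + rscale t (z - xs)))).
  by apply: linear_sub; exact: diff_linear.
by apply: bounded_op_sub; apply: diff_bounded => //; exact: oball_segment.
Qed.

Lemma linearization_error z : oball xs kappa z -> hnorm (z - xs) < rad ->
  beta * hnorm (F z - F xs - 'd F z (z - xs)) <= H (hnorm (z - xs)).
Proof.
move=> zk; set h := z - xs; set e := hnorm h => er.
have e0 : 0 <= e by exact: hnorm_ge0.
pose pt t := xs + rscale t h.
(* Subtracting the linear part at the endpoint [z] gives [phi] the derivative
   [(F'(pt t) - F'(z)) h]. The Lipschitz condition bounds [beta] times its norm by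
   [e (G e - G (t e))], the formal derivative of [psi]. *)
pose phi t := F (pt t) - rscale t ('d F z h).
pose psi t := t * e * (G e - G (t * e)) + H (t * e).
have -> : F z - F xs - 'd F z h = phi 1 - phi 0.
  have xsh : xs + h = z by rewrite /h addrC subrK.
  by rewrite /phi /pt !rscale1 !rscale0 subr0 addr0 xsh addrAC.
have -> : H e = psi 1 - psi 0.
  by rewrite /psi !mul1r !mul0r subrr mulr0 add0r add0r /H defint_xx subr0.
apply: norm_increment_le => // t eps t01 eps0.
have /andP[t0 t1] := t01.
(* The slack is spent as [e e1] on the variation of [G] between [t e] and [t' e], and as [beta e e1]
   on the first-order remainder of [F]. The added 1's keep the denominator positive. *)
pose e1 := eps / ((1 + beta) * (e + 1)).
have b1 : 0 < 1 + beta by rewrite ltr_wpDr.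
have ep1 : 0 < e + 1 by rewrite ltr_wpDl.
have e1_gt0 : 0 < e1 by rewrite divr_gt0 // mulr_gt0.
have e1E : (e + beta * e) * e1 <= eps.
  have -> : eps = ((1 + beta) * (e + 1)) * e1.
    by rewrite /e1 mulrC divfK // gt_eqF // mulr_gt0.
  by rewrite ler_wpM2r ?(ltW e1_gt0) //; lra.
have te01 a : 0 <= a <= 1 -> 0 <= a * e <= e.
  by move=> /andP[a0 a1]; rewrite mulr_ge0 // ler_piMl.
have [d1 d1_gt0 hd1] := differentiable_expansion (F_diff (oball_segment zk t01)) e1_gt0.
have [d2 d2_gt0 hd2] := intL_continuous L_int er (te01 _ t01) e1_gt0.
exists (Num.min d1 d2 / (e + 1)); first by rewrite divr_gt0 // lt_min d1_gt0.
move=> t' t'01; rewrite ltr_pdivlMr // => ht'.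
have /andP[t'0 t'1] := t'01.
have tt'e : `|t' - t| * e < Num.min d1 d2.
  by apply: le_lt_trans ht'; rewrite ler_wpM2l // lerDl.
move: tt'e; rewrite lt_min => /andP[td1 td2].
pose k := rscale (t' - t) h.
have kE : hnorm k = `|t' - t| * e by rewrite hnorm_rscale.
have ptE : pt t' = pt t + k by rewrite /pt /k rscaleBl -addrA [_ + (_ - _)]addrC subrK.
have main : beta * hnorm (phi t' - phi t) <=
    `|t' - t| * (e * (G e - G (t * e)) + beta * e * e1).
  have -> : phi t' - phi t =
      (F (pt t + k) - F (pt t) - 'd F (pt t) k) - ('d F z k - 'd F (pt t) k).
    rewrite /phi -ptE.
    have -> : 'd F z k = rscale t' ('d F z h) - rscale t ('d F z h).
      by rewrite -rscaleBl linear_rscaleE //; exact: diff_linear.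
    exact: subr_cancel_common.
  apply: le_trans (ler_wpM2l beta_ge0 (hnormB _ _)) _; rewrite mulrDr.
  have r1 : beta * hnorm (F (pt t + k) - F (pt t) - 'd F (pt t) k) <=
      beta * (e1 * hnorm k).
    by rewrite ler_wpM2l // hd1 // kE.
  have r2 := diff_lip k zk t01 er.
  apply: le_trans (lerD r1 r2) _; rewrite kE -/h -/e; move: `|_| => q; lra.
have slack : `|t' - t| * (e * e1 + beta * e * e1) <= eps * `|t' - t|.
  by rewrite mulrC ler_wpM2r // -mulrDl.
have := hd2 (t' * e) (te01 _ t'01).
rewrite -mulrBl normrM (ger0_norm e0) => /(_ td2).
rewrite ltr_norml => /andP[_ Gt'].
(* [majorant_increment] evaluates [G] at the larger point. For [t <= t'] that is [t' e], and
   continuity of [G] leads back to [t e]; for [t' <= t] it is [t e] already. *)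
split=> tt'.
  have at0 : 0 <= t' - t by rewrite subr_ge0.
  have tte : t * e <= t' * e by rewrite ler_wpM2r.
  have /andP[te0 _] := te01 _ t01; have /andP[_ t'ee] := te01 _ t'01.
  have := majorant_increment L_gt0 L_int te0 tte t'ee er.
  rewrite -/(G _) -/(G (t * e)) -/(G (t' * e)) -/(H _) -/(H (t * e)) -/(psi t) -/(psi t').
  move: main slack; rewrite ger0_norm // => main slack incr.
  have h3 := ler_wpM2l (mulr_ge0 at0 e0) (ltW Gt').
  by move: h3 incr main slack; rewrite /psi /G /H; lra.
have at0 : 0 <= t - t' by rewrite subr_ge0.
have tte : t' * e <= t * e by rewrite ler_wpM2r.
have /andP[t'e0 _] := te01 _ t'01; have /andP[_ tee] := te01 _ t01.
have := majorant_increment L_gt0 L_int t'e0 tte tee er.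
have h4 : 0 <= (t - t') * (e * e1).
  exact: (mulr_ge0 at0 (mulr_ge0 e0 (ltW e1_gt0))).
rewrite hdistC.
rewrite distrC (ger0_norm at0) in main; rewrite distrC (ger0_norm at0) in slack.
move: main slack.
by rewrite /psi /G /H; lra.
Qed.

End Linearization.
End OneStep.

Section InexactStep.
Context {R : realType} {s : scalar_kind}.
Implicit Types X Y Z : hilbertType R s.

Lemma opinv_comp X Y Z (A : X -> Y) (B : Y -> Z) :
  op_invertible A -> op_invertible B -> opinv (B \o A) = opinv A \o opinv B.
Proof.
move=> /op_invertibleP[_ _ A1 A2] /op_invertibleP[_ _ B1 B2].
by apply: opinvE => x /=; rewrite ?B1 ?A1 ?A2 ?B2.
Qed.

(** From [v = (P N)^-1 (P (N v))], the norms of [(P N)^-1] and [P N] multiply to the condition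
    number and the preconditioner disappears. *)
Lemma preconditioned_residual X (N P : X -> X) (theta th : R) (v w : X) :
  op_invertible N -> op_invertible P -> 0 <= th ->
  0 <= theta * cond (P \o N) <= th ->
  hnorm (P (N v)) <= theta * hnorm (P (N w)) -> hnorm v <= th * hnorm w.
Proof.
move=> iN iP th0 /andP[_ hth] hv.
have [[lN bN] [lN' bN'] N1 N2] := op_invertibleP iN.
have [[lP bP] [lP' bP'] P1 P2] := op_invertibleP iP.
have lPN : linear (P \o N) by exact: linear_comp.
have bPN : bounded_op (P \o N) by exact: bounded_op_comp.
have lI : linear (opinv (P \o N)) by rewrite opinv_comp //; exact: linear_comp.
have bI : bounded_op (opinv (P \o N)).
  by rewrite opinv_comp //; exact: bounded_op_comp.
have vE : hnorm v <= opnorm (opinv (P \o N)) * hnorm (P (N v)).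
  have := opnormP (P (N v)) lI bI.
  by rewrite [in X in X <= _ -> _]opinv_comp //= P1 N1.
have I0 := opnorm_ge0 bI.
(* Only the product of [theta] with [cond] is known to be nonnegative. A negative [theta] forces
   [P (N v)] to have norm 0, hence [v] too. *)
have [theta0|theta0] := leP 0 theta.
  apply: le_trans vE _; apply: le_trans (ler_wpM2l I0 hv) _.
  apply: le_trans (ler_wpM2r (hnorm_ge0 w) hth).
  have := opnormP w lPN bPN; rewrite /= /cond => hw.
  have := ler_wpM2l (mulr_ge0 I0 theta0) hw; lra.
have Pv0 : hnorm (P (N v)) <= 0.
  by apply: le_trans hv _; rewrite mulr_le0_ge0 // ltW.
apply: (@le_trans _ _ 0); last exact: mulr_ge0.
by apply: le_trans vE _; rewrite mulr_ge0_le0.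
Qed.

(* With [u = (A^* A)^-1 A^* (A h - y)] and [v = (A^* A)^-1 r], the new error is
   [(h - B^-1 A^*A h) + B^-1 A^*A u + B^-1 A^*A v]. *)
Lemma inexact_step_bound X Y (A : X -> Y) (B P : X -> X) (h S r : X) (y : Y)
    (w1 w2 theta th q : R) :
  linear A -> bounded_op A -> op_invertible (adjoint A \o A) ->
  op_invertible B -> op_invertible P -> 0 <= w1 -> 0 <= th ->
  opnorm (opinv B \o (adjoint A \o A)) <= w1 ->
  opnorm ((opinv B \o (adjoint A \o A)) \- idfun) <= w2 ->
  hnorm (P r) <= theta * hnorm (P (adjoint A y)) ->
  0 <= theta * cond (P \o (adjoint A \o A)) <= th ->
  B S = - adjoint A y + r ->
  (forall u, adjoint A (A u) = adjoint A (A h - y) -> hnorm u <= q) ->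
  hnorm (h + S) <= (1 + th) * w1 * q + (w1 * th + w2) * hnorm h.
Proof.
move=> lA bA iN iB iP w1_0 th0 hw1 hw2 hr hcond BS hq.
pose N := adjoint A \o A.
have [[lN bN] [lN' bN'] N1 N2] := op_invertibleP iN.
have [[lB bB] [lB' bB'] B1 B2] := op_invertibleP iB.
have lA' := adjoint_linear lA bA.
pose u := opinv N (adjoint A (A h - y)); pose v := opinv N r.
have Nu : N u = adjoint A (A h - y) by exact: N2.
have Nv : N v = r by exact: N2.
have uq : hnorm u <= q by apply: hq; exact: Nu.
have yE : adjoint A y = N (h - u).
  by rewrite linear_subE // Nu linear_subE // subKr.
have vh : hnorm v <= th * hnorm (h - u).
  apply: (preconditioned_residual iN iP th0 hcond).
  by rewrite -[(_ \o _) v]/(N v) -[(_ \o _) (h - u)]/(N (h - u)) Nv -yE.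
pose T := opinv B \o N.
have lT : linear T by exact: linear_comp.
have bT : bounded_op T by exact: bounded_op_comp.
have SE : S = opinv B (- adjoint A y + r) by rewrite -BS B1.
have -> : h + S = - (T h - h) + T u + T v.
  rewrite SE (linear_addE lB') (linear_oppE lB') yE -Nv.
  rewrite -[opinv B (N v)]/(T v) -[opinv B (N (h - u))]/(T (h - u)).
  by rewrite (linear_subE lT) !opprB !addrA (addrAC h (T u)).
have hT z : hnorm (T z) <= w1 * hnorm z by exact: opnorm_leP.
have hTI : hnorm (T h - h) <= w2 * hnorm h.
  apply: (@opnorm_leP _ _ _ _ (T \- idfun)) => //.
    by apply: linear_sub.
  apply: bounded_op_sub => //; exists 1 => // z; by rewrite mul1r.
apply: le_trans (hnormD _ _) _; apply: le_trans (lerD (hnormD _ _) (lexx _)) _.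
rewrite hnormN.
(* [|T u| <= w1 q], and [|T v| <= w1 th |h - u| <= w1 th (|h| + q)]. This is the origin of the
   factor [1 + th] on [q] and of [w1 th] on [|h|]. *)
have h1 := hT u; have h2 := hT v.
have h3 := ler_wpM2l w1_0 vh.
have h4 := ler_wpM2l (mulr_ge0 w1_0 th0) (hnormB h u).
have h5 := ler_wpM2l w1_0 uq; have h6 := ler_wpM2l th0 h5.
by move: hTI h1 h2 h3 h4 h5 h6; lra.
Qed.

Lemma mp_inverseK X Y (A : X -> Y) : linear A -> bounded_op A ->
  op_invertible (adjoint A \o A) ->
  [/\ linear (mp_inverse A), bounded_op (mp_inverse A) &
      cancel A (mp_inverse A)].
Proof.
move=> lA bA /op_invertibleP[[_ _] [lI bI] K1 _]; split.
- by apply: linear_comp => //; exact: adjoint_linear.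
- by apply: bounded_op_comp => //; exact: adjoint_bounded.
- by move=> x; rewrite /mp_inverse /=; exact: K1.
Qed.

(** [opnorm] is meaningful for a bounded operator only. So the closed range first provides some
    lower bound [c], hence boundedness of [A^+], and then [A^+ A = I] provides the constant
    [|A^+|]. *)
Lemma mp_inverse_lower_bound X Y (A : X -> Y) :
  linear A -> bounded_op A -> injective A -> closed (range A) ->
  0 <= opnorm (mp_inverse A) /\
  forall v, hnorm v <= opnorm (mp_inverse A) * hnorm (A v).
Proof.
move=> lA bA iA /closed_adherent cA.
have [c c0 hc] := injective_closed_range lA bA iA cA.
have [lM bM MK] := mp_inverseK lA bA (normal_invertible lA bA c0 hc).
split=> [|v]; first exact: opnorm_ge0.
by rewrite -[in leLHS](MK v) opnormP.
Qed.

End InexactStep.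

(** * Invertibility and least-squares estimates near the solution *)

Section NormalOperator.
Context {R : realType} {s : scalar_kind} (X Y : hilbertType R s).
Variables (F : X -> Y) (xs : X) (kappa rad : R) (L : R -> R).
Hypothesis L_gt0 : forall u, 0 <= u < rad -> 0 < L u.
Hypothesis L_int : lebesgue_measure.-integrable `[0, rad[ (EFin \o L).
Hypothesis F_diff : forall z, oball xs kappa z -> differentiable F z.
Hypothesis kappa_gt0 : 0 < kappa.
Hypothesis F_xs : F xs = 0.
Hypothesis dF_inj : injective ('d F xs).
Hypothesis dF_closed : closed (range ('d F xs)).
Hypothesis F_lip : forall (tau : R) (z : X), 0 <= tau <= 1 -> oball xs kappa z ->
  opnorm (mp_inverse ('d F xs)) *
    opnorm ('d F z \- 'd F (xs + scalar_of_real s tau *: (z - xs)))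
    <= defint (tau * hnorm (z - xs)) (hnorm (z - xs)) L.

Let G a := defint 0 a L.
Let H a := defint 0 a (fun u => L u * u).
Let beta := opnorm (mp_inverse ('d F xs)).

Let xs_ball : oball xs kappa xs.
Proof. by rewrite /oball /= subrr hnorm0. Qed.

Let beta_bound : 0 <= beta /\ forall v, hnorm v <= beta * hnorm ('d F xs v).
Proof.
by apply: mp_inverse_lower_bound => //; [exact: diff_linear|exact: (diff_bounded F_diff)].
Qed.

(** The Lipschitz condition at [tau = 0] gives [|v| <= beta |F'(xs) v| <= beta |F'(z) v| + G e
    |v|]. *)
Lemma diff_lower_bound z v : oball xs kappa z -> hnorm (z - xs) < rad ->
  (1 - G (hnorm (z - xs))) * hnorm v <= beta * hnorm ('d F z v).
Proof.
move=> zk er; have [b0 hb] := beta_bound.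
have := diff_lip L_int F_diff b0 F_lip v zk (introT andP (conj (lexx 0) ler01)) er.
rewrite mul0r rscale0 addr0 /G [defint 0 0 L]defint_xx subr0.
have := hb v; have := ler_wpM2l b0 (hnormB ('d F z v) ('d F z v - 'd F xs v)).
by rewrite subKr; lra.
Qed.

Lemma normal_op_invertible z : oball xs kappa z -> hnorm (z - xs) < rad ->
  G (hnorm (z - xs)) < 1 -> op_invertible (normal_op F z).
Proof.
move=> zk er G1; have [b0 _] := beta_bound.
have G1' : 0 < 1 - G (hnorm (z - xs)) by rewrite subr_gt0.
apply: (@normal_invertible _ _ _ _ _ (beta / (1 - G (hnorm (z - xs))))).
- exact: diff_linear.
- exact: (diff_bounded F_diff).
- by rewrite divr_ge0 // ltW.
- by move=> v; rewrite mulrAC ler_pdivlMr // mulrC diff_lower_bound.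
Qed.

(** With [A = F'(z)] and [h = z - xs]: [(1 - G e) |u| <= beta |A u| <= beta |A h - F z| <= H e], the
    middle step because [A u] is a projection of [A h - F z]. *)
Lemma least_squares_bound z u : oball xs kappa z -> hnorm (z - xs) < rad ->
  G (hnorm (z - xs)) < 1 ->
  adjoint ('d F z) ('d F z u) = adjoint ('d F z) ('d F z (z - xs) - F z) ->
  hnorm u <= H (hnorm (z - xs)) / (1 - G (hnorm (z - xs))).
Proof.
move=> zk er G1 hu; have [b0 _] := beta_bound.
rewrite ler_pdivlMr ?subr_gt0 // mulrC.
apply: le_trans (diff_lower_bound u zk er) _.
have le_u := least_squares_norm (@diff_linear _ _ _ _ F z) (diff_bounded F_diff zk) hu.
apply: le_trans (ler_wpM2l b0 le_u) _.
have := linearization_error L_gt0 L_int F_diff b0 F_lip zk er.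
by rewrite F_xs subr0 (hdistC (F z)).
Qed.

End NormalOperator.

(** * Convergence of the method *)

Lemma limn_esup_le (R : realType) (u v : nat -> R) (l : R) :
  (forall n, u n <= v n) -> v @ \oo --> l ->
  (limn_esup (fun n => (u n)%:E) <= l%:E)%E.
Proof.
move=> uv vl; apply/lee_addgt0Pr => e e0.
have /cvgrPdist_lt /(_ e e0) near_v := vl.
(* The limsup is an infimum over eventual sets of indices, and the set where [v n] is within [e] of
   [l] is one of them. *)
apply: ge_ereal_inf; eexists; first by exists [set n | `|l - v n| < e].
apply: ge_ereal_sup => _ [n /= ln <-].
rewrite -EFinD lee_fin; apply: le_trans (uv n) _.
by move: ln; rewrite ltr_distl => /andP[h _]; rewrite -lerBlDr ltW.
Qed.

Lemma oball_kappa_radius (R : realType) (s : scalar_kind) (X : hilbertType R s)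
    (Omega : set X) (xs : X) (rad : R) z :
  oball xs (kappa_radius Omega xs rad) z -> Omega z /\ hnorm (z - xs) < rad.
Proof.
rewrite /oball /= => /(lt_sup_exists (hnorm_ge0 _))[t [/andP[_ tr] tO] zt].
by split; [exact: tO|exact: lt_trans tr].
Qed.

Unset Implicit Arguments.
Theorem theorem14 (R : realType) (s : scalar_kind) (X Y : hilbertType R s)
  (Omega : set X) (F : X -> Y) (xs : X) (rad : R) (L : R -> R)
  (th w1 w2 : R)
  (x S r : nat -> X) (B : X -> {linear X -> X}) (P : nat -> {linear X -> X})
  (theta : nat -> R) (t : nat -> R)
  (beta := opnorm (mp_inverse ('d F xs)))
  (kappa := kappa_radius Omega xs rad)
  (nubar := nu_bar L rad)
  (rbar := Num.min kappa (rho_bar L rad th w1 w2))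
  (hOmega : open Omega)
  (hF : continuously_differentiable_on Omega F)
  (hclosed : forall z, Omega z -> closed (range ('d F z)))
  (hxs : Omega xs)
  (hrad : 0 < rad)
  (hFxs : F xs = 0)
  (hinj : injective ('d F xs))
  (hLpos : forall u, 0 <= u < rad -> 0 < L u)
  (hLint : lebesgue_measure.-integrable `[0, rad[ (EFin \o L))
  (hLip : forall (tau : R) (z : X), 0 <= tau <= 1 -> oball xs kappa z ->
     beta * opnorm ('d F z \- 'd F (xs + scalar_of_real s tau *: (z - xs)))
       <= defint (tau * hnorm (z - xs)) (hnorm (z - xs)) L)
  (hth : 0 <= th < 1) (hw : 0 <= w2 < w1) (hthw : w1 * th + w2 < 1)
  (hx0 : oball xs rbar (x 0%N)) (hx0' : x 0%N <> xs)
  (hB : forall k, admissible Omega F (x k) ->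
     [/\ op_invertible (B (x k)),
         opnorm (opinv (B (x k)) \o normal_op F (x k)) <= w1 &
         opnorm ((opinv (B (x k)) \o normal_op F (x k)) \- idfun) <= w2])
  (hP : forall k, admissible Omega F (x k) ->
     [/\ op_invertible (P k),
         hnorm (P k (r k))
           <= theta k * hnorm (P k (adjoint ('d F (x k)) (F (x k)))) &
         0 <= theta k * cond (P k \o normal_op F (x k)) <= th])
  (hx : forall k, admissible Omega F (x k) ->
     x k.+1 = x k + S k /\
     B (x k) (S k) = - adjoint ('d F (x k)) (F (x k)) + r k)
  (ht0 : t 0%N = hnorm (x 0%N - xs))
  (ht : forall k, t k.+1 =
     (1 + th) * w1 * defint 0 (t k) (fun u => L u * u)
       / (1 - defint 0 (t k) L) + (w1 * th + w2) * t k) :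
  [/\ (forall k, admissible Omega F (x k) /\
         exists! v, B (x k) v = - adjoint ('d F (x k)) (F (x k)) + r k),
      (forall k, 0 <= t k < rad /\ 1 - defint 0 (t k) L != 0) &
      [/\ decreasing_seq t,
          forall k, 0 < t k < rbar &
          t @ \oo --> (0 : R)]] /\
  [/\ forall k, oball xs rbar (x k),
      x @ \oo --> xs,
      (limn_esup (fun k => (hnorm (x k.+1 - xs) / hnorm (x k - xs))%:E)
         <= (w1 * th + w2)%:E)%E &
      t k.+1 / t k @[k --> \oo] --> w1 * th + w2] /\
  (forall p : R, 0 <= p <= 1 ->
     {in `]0, nubar[ &, {homo (fun u => u `^ (1 - p) * L u) :
         u v / u <= v}} ->
     (forall k, hnorm (x k.+1 - xs) <=
        (1 + th) * w1 *
          (defint 0 (t 0%N) (fun u => L u * u)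
             / (t 0%N `^ (p + 1) * (1 - defint 0 (t 0%N) L)))
          * hnorm (x k - xs) `^ (p + 1)
        + (w1 * th + w2) * hnorm (x k - xs)) /\
     (forall k, hnorm (x k - xs) <= t k)).
Proof.
have [th0 th1] := andP hth; have [w2_0 w21] := andP hw.
have w1_gt0 : 0 < w1 := le_lt_trans w2_0 w21.
pose e k := hnorm (x k - xs).
pose rho := rho_bar L rad th w1 w2.
pose G a := defint 0 a L; pose H a := defint 0 a (fun u => L u * u).
pose step := majorant_step L th w1 w2.
have e0 k : 0 <= e k by exact: hnorm_ge0.
have [e0_kappa e0_rho] : e 0%N < kappa /\ e 0%N < rho.
  by move: hx0; rewrite /oball /= lt_min => /andP[].
have rbarE z : z < rbar = (z < kappa) && (z < rho) by rewrite lt_min.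
have kappa_gt0 : 0 < kappa by exact: le_lt_trans (e0 _) e0_kappa.
have ball_Omega z : oball xs kappa z -> Omega z /\ hnorm (z - xs) < rad.
  exact: oball_kappa_radius.
have F_diff z : oball xs kappa z -> differentiable F z.
  by move=> /ball_Omega[/hF[]].
have dF_closed := hclosed _ hxs.
have G_lt1 a : 0 <= a -> a < rho -> a < rad /\ G a < 1.
  exact: (lt_rho hLpos hLint).
have adm k : e k < rbar -> admissible Omega F (x k).
  rewrite rbarE => /andP[ek er]; have [xO xrad] := ball_Omega _ ek.
  split=> //; have [_ G1] := G_lt1 _ (e0 k) er.
  exact: (normal_op_invertible hLint F_diff kappa_gt0 hinj dF_closed hLip ek
    xrad G1).
have one_step k : e k < rbar -> e k.+1 <= step (e k).
  move=> ekr; have ak := adm _ ekr; have [_ iN] := ak.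
  move: ekr; rewrite rbarE => /andP[ek er].
  have [xO xrad] := ball_Omega _ ek; have [_ G1] := G_lt1 _ (e0 k) er.
  have [iB hB1 hB2] := hB _ ak; have [iP hP1 hP2] := hP _ ak.
  have [xS BS] := hx _ ak.
  have -> : e k.+1 = hnorm (x k - xs + S k) by rewrite /e xS addrAC.
  rewrite /step /majorant_step -(mulrA ((1 + th) * w1)).
  apply: (inexact_step_bound (diff_linear F (x k)) (diff_bounded F_diff ek)
    iN iB iP (ltW w1_gt0) th0 hB1 hB2 hP1 hP2 BS) => u hu.
  exact: (least_squares_bound hLpos hLint F_diff kappa_gt0 hFxs hinj dF_closed
    hLip ek xrad G1 hu).
have step_le a : 0 <= a -> a < rho -> step a <= a.
  exact: (majorant_step_le hLpos hLint).
(* Membership in the ball gives admissibility, admissibility gives the step estimate, and the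
   estimate keeps the next iterate in the ball. *)
have e_rbar k : e k < rbar.
  elim: k => // k IH; apply: le_lt_trans (one_step _ IH) _.
  move: (IH); rewrite rbarE => /andP[_ er].
  exact: le_lt_trans (step_le _ (e0 k) er) IH.
have e_rho k : e k < rho by have := e_rbar k; rewrite rbarE => /andP[].
have e_step k : e k.+1 <= step (e k) by exact: one_step.
have tS k : t k.+1 = step (t k) by rewrite ht.
have t0E : t 0%N = e 0%N := ht0.
have t_in k : 0 < t k < rbar.
  elim: k => [|k /andP[tk tr]].
    by rewrite t0E e_rbar andbT hnorm_gt0 subr_eq0; exact/eqP.
  have : t k < rho by move: tr; rewrite rbarE => /andP[].
  move=> trho; rewrite tS; apply/andP; split.
    exact: (majorant_step_gt0 hLpos hLint th0 w1_gt0 w2_0).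
  exact: le_lt_trans (step_le _ (ltW tk) trho) tr.
have t_gt0 k : 0 < t k by have /andP[] := t_in k.
have t_rho k : t k < rho by have /andP[_] := t_in k; rewrite rbarE => /andP[].
have [e_le e_cvg] : (forall n, e n <= e 0%N) /\ e @ \oo --> (0 : R).
  exact: (majorized_cvg0 hLpos hLint e0 e0_rho (fun k _ => e_step k)).
have [t_le t_cvg] : (forall n, t n <= t 0%N) /\ t @ \oo --> (0 : R).
  apply: (majorized_cvg0 hLpos hLint (fun k => ltW (t_gt0 k)) (t_rho 0%N)).
  by move=> k _; rewrite tS.
have [e0_rad G_e0] := G_lt1 _ (e0 0%N) e0_rho.
(* The upper bound of [majorant_step_bounds] along any null sequence; it serves for both [e] and
   [t]. *)
have ratio_cvg (u : nat -> R) : (forall n, 0 <= u n <= e 0%N) ->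
    u @ \oo --> (0 : R) ->
    (1 + th) * w1 * (G (u k) / (1 - G (u k))) + (w1 * th + w2) @[k --> \oo]
      --> w1 * th + w2.
  move=> u_in u0; have z_in : 0 <= (0 : R) <= e 0%N by rewrite lexx e0.
  have := intL_cvg hLint e0_rad u_in z_in u0; rewrite [defint 0 0 L]defint_xx => Gu.
  rewrite -[X in _ --> X]add0r; apply: cvgD; last exact: cvg_cst.
  rewrite -(mulr0 ((1 + th) * w1)); apply: cvgMr.
  rewrite -(mul0r (1 - 0)^-1); apply: cvgM => //; apply: cvgV.
    by rewrite subr0 oner_eq0.
  by apply: cvgB; first exact: cvg_cst.
split; [split|split; [split|]].
- move=> k; split; first exact: adm.
  have [iB _ _] := hB _ (adm _ (e_rbar k)).
  have [_ _ B1 B2] := op_invertibleP iB.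
  exists (opinv (B (x k)) (- adjoint ('d F (x k)) (F (x k)) + r k)).
  by split=> [|v <-]; [exact: B2|exact: B1].
- move=> k; have [trad Gt] := G_lt1 _ (ltW (t_gt0 k)) (t_rho k).
  by rewrite trad (ltW (t_gt0 k)) gt_eqF // subr_gt0.
- split=> //; apply/decreasing_seqP => k.
  by rewrite tS; exact: (majorant_step_lt hLpos hLint).
- exact: e_rbar.
- apply/hcvgP => eps eps0; have /cvgrPdist_lt /(_ _ eps0) [N _ hN] := e_cvg.
  exists N => n /hN /=; rewrite sub0r normrN ger0_norm //.
- apply: (limn_esup_le _ (ratio_cvg e _ e_cvg)) => n; last by rewrite e0 e_le.
  rewrite -/(e n) -/(e n.+1).
  (* An iterate may coincide with [xs]; the quotient is then 0 by the convention on division. *)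
  have [en0|en0] := eqVneq (e n) 0; last first.
    have en_gt0 : 0 < e n by rewrite lt_neqAle eq_sym en0 e0.
    apply: le_trans (_ : step (e n) / e n <= _).
      by rewrite ler_wpM2r // invr_ge0.
    by have /andP[] := majorant_step_bounds hLpos hLint th0 w1_gt0 en_gt0 (e_rho n).
  by rewrite en0 invr0 mulr0 /G defint_xx mul0r mulr0 add0r addr_ge0 // mulr_ge0 // ltW.
- apply: (squeeze_cvgr (f := fun=> w1 * th + w2)); last 2 first.
  + exact: cvg_cst.
  + by apply: (ratio_cvg t _ t_cvg) => n; rewrite ltW //= -t0E t_le.
  apply: nearW => k /=; rewrite tS.
  exact: (majorant_step_bounds hLpos hLint th0 w1_gt0 (t_gt0 k) (t_rho k)).
have e_le_t k : e k <= t k.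
  elim: k => [|k IH]; first by rewrite ht0.
  rewrite tS; apply: le_trans (e_step k) _.
  exact: (majorant_step_mono hLpos hLint th0 w1_gt0 w2_0).
move=> p /andP[p0 p1] Lmono; split=> // k; rewrite -/(e k) -/(e k.+1).
apply: le_trans (e_step k) _; rewrite /step /majorant_step lerD2r.
have p1_gt0 : 0 < p + 1 by rewrite ltr_wpDl.
have c1 : 0 <= (1 + th) * w1 by rewrite mulr_ge0 ?addr_ge0 // ltW.
rewrite t0E -!(mulrA ((1 + th) * w1)) ler_wpM2l //.
have G1 : 0 < 1 - G (e 0%N) by rewrite subr_gt0.
have [->|ek0] := eqVneq (e k) 0.
  by rewrite defint_xx mul0r powR0 ?gt_eqF // !mulr0.
have ek_gt0 : 0 < e k by rewrite lt_neqAle eq_sym ek0 e0.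
have e0_nu := lt_rho_nu (e0 0%N) e0_rho.
(* Numerator and denominator are compared separately with their values at [e 0 = t 0]: [H] through
   the monotone ratio, [1 / (1 - G)] through the monotonicity of [G]. *)
have ratio := powR_ratio_le hLpos hLint p0 ek_gt0 (e_le k) e0_nu Lmono.
have ekp : 0 < e k `^ (p + 1) by rewrite powR_gt0.
rewrite ler_pdivrMr // in ratio.
have Gk : G (e k) <= G (e 0%N) by exact: (intL_le hLpos hLint (e0 k) (e_le k)).
have He0 : 0 <= H (e 0%N) by exact: (intLu_ge0 hLpos hLint).
rewrite invfM mulrA -[leRHS]mulrA (mulrC _ (e k `^ _)) mulrA.
apply: ler_pM => //.
- exact: (intLu_ge0 hLpos hLint (e0 k) (le_lt_trans (e_le k) e0_rad)).
- by rewrite invr_ge0 subr_ge0 ltW // (le_lt_trans Gk).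
- by rewrite lef_pV2 ?posrE ?subr_gt0 ?lerB // (le_lt_trans Gk).
Qed.
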